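(* Let $\hat{\mathcal{A}}\otimes\mathcal{A}$ be given the multiplication \begin{align*} &\bigl((\phi\otimes f)\times(\psi\otimes g)\bigr)(x,y,r;x',y',r')\\ &=\int\phi(e^{\lambda\tilde{r}}x,e^{\lambda\tilde{r}}y,r-\tilde{r})\,\psi(x-e^{\lambda(r'-\tilde{r})}\tilde{x}+e^{-\lambda\tilde{r}}\tilde{x},\,y-e^{\lambda(r'-\tilde{r})}\tilde{y}+e^{-\lambda\tilde{r}}\tilde{y},\,\tilde{r})\\ &\quad \bar{e}[\eta_\lambda(r')\beta(e^{-\lambda\tilde{r}}\tilde{x},y')]\,e[\eta_\lambda(\tilde{r})\beta(x,e^{-\lambda\tilde{r}}\tilde{y})]\,\bar{e}[\eta_\lambda(\tilde{r})\beta(e^{\lambda(r'-\tilde{r})}\tilde{x},y)]\\ &\quad e[\eta_\lambda(r')\beta(\tilde{x},\tilde{y})]\,e[\eta_\lambda(\tilde{r})\beta(e^{-\lambda\tilde{r}}\tilde{x},e^{-\lambda\tilde{r}}\tilde{y})]\,\bar{e}[\eta_\lambda(\tilde{r})\beta(e^{\lambda(r'-\tilde{r})}\tilde{x},e^{-\lambda\tilde{r}}\tilde{y})]\\ &\quad f(\tilde{x},\tilde{y},r')\,g(x'-e^{-\lambda\tilde{r}}\tilde{x},y'-e^{-\lambda\tilde{r}}\tilde{y},r')\,d\tilde{x}d\tilde{y}d\tilde{r}. \end{align*} Then, for $\phi,\psi\in\hat{\mathcal{A}}$ and $f,g\in\mathcal{A}$, $$\Pi(\phi\otimes f)\Pi(\psi\otimes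 g)=\Pi\bigl((\phi\otimes f)\times(\psi\otimes g)\bigr).$$
   Context: Setting. Fix an integer $n\ge 1$ and $\lambda\in\mathbb{R}$. Let $\mathcal{H}=L^2(\mathbb{R}^{n}\times\mathbb{R}^n\times\mathbb{R})$, functions $\xi(x,y,r)$ with $x,y\in\mathbb{R}^n$, $r\in\mathbb{R}$. $\beta$ is the inner product on $\mathbb{R}^n$, $e(t)=e^{2\pi i t}$, $\bar{e}(t)=e^{-2\pi i t}$, $\eta_\lambda(r)=\frac{e^{2\lambda r}-1}{2\lambda}$ (and $\eta_0(r)=r$). Let $Z$ be the unitary operator on $\mathcal{H}\otimes\mathcal{H}$ $$Z\xi(x,y,r;x',y',r')=(e^{\lambda r})^n\bar{e}[\eta_\lambda(r)\beta(e^{\lambda r'}x',y-e^{\lambda r'}y')]\,e[\eta_\lambda(r)\beta(x-e^{\lambda r'}x',y')]\,\xi(x-e^{\lambda r'}x'+x',y-e^{\lambda r'}y'+y',r;e^{\lambda r}x',e^{\lambda r}y',r').$$ $\mathcal{A}=\hat{\mathcal{A}}$ is the space of Schwartz functions in $(x,y,r)$ with compact support in $r$. For $f\in\mathcal{A}$, $(L_f\xi)(x,y,r)=\int f(\tilde{x},\tilde{y},r)\xi(x-\tilde{x},y-\tilde{y},r)\bar{e}[\eta_\lambda(r)\beta(\tilde{x},y-\tilde{y})]\,d\tilde{x}d\tilde{y}$; for $\phi\in\hat{\mathcal{A}}$, $(\lambda_\phi\xi)(x,y,r)=\int\phi(e^{\lambda\tilde{r}}x,e^{\lambda\tilde{r}}y,r-\tilde{r})\xi(x,y,\tilde{r})\,d\tilde{r}$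 (operators on $\mathcal{H}$). Put $\pi(a)=Z(1\otimes a)Z^*$, $\pi'(b)=b\otimes1$ and $\Pi(\phi\otimes f)=\pi'(\lambda_\phi)\pi(L_f)\in\mathcal{B}(\mathcal{H}\otimes\mathcal{H})$. $\Pi$ extends to Schwartz functions $F$ of $(x,y,r;x',y',r')$ with compact support in $r$ and $r'$ (elements of $\hat{\mathcal{A}}\otimes\mathcal{A}$ being understood as such functions) by \begin{align*} \Pi(F)\xi(x,y,r;x',y',r')=\int& F(e^{\lambda\tilde{r}}x,e^{\lambda\tilde{r}}y,r-\tilde{r};\tilde{x},\tilde{y},r')\,\bar{e}[\eta_\lambda(r')\beta(e^{-\lambda\tilde{r}}\tilde{x},y')]\,e[\eta_\lambda(\tilde{r})\beta(x,e^{-\lambda\tilde{r}}\tilde{y})]\\ &\bar{e}[\eta_\lambda(\tilde{r})\beta(e^{\lambda(r'-\tilde{r})}\tilde{x},y)]\,e[\eta_\lambda(r')\beta(\tilde{x},\tilde{y})]\,e[\eta_\lambda(\tilde{r})\beta(e^{-\lambda\tilde{r}}\tilde{x},e^{-\lambda\tilde{r}}\tilde{y})]\\ &\bar{e}[\eta_\lambda(\tilde{r})\beta(e^{\lambda(r'-\tilde{r})}\tilde{x},e^{-\lambda\tilde{r}}\tilde{y})]\,\xi(x-e^{\lambda(r'-\tilde{r})}\tilde{x}+e^{-\lambda\tilde{r}}\tilde{x},\,y-e^{\lambda(r'-\tilde{r})}\tilde{y}+e^{-\lambda\tilde{r}}\tilde{y},\,\tilde{r};\\ &\quad x'-e^{-\lambda\tilde{r}}\tilde{x},\,y'-e^{-\lambda\tilde{r}}\tilde{y},\,r')\,d\tilde{x}d\tilde{y}d\tilde{r},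 \end{align*} which for $F=\phi\otimes f$ agrees with $\pi'(\lambda_\phi)\pi(L_f)$. *)

(* Defs.v *)
From HB Require Import structures.
From mathcomp Require Import all_boot all_order all_algebra.
From mathcomp Require Import all_classical all_reals all_analysis.
From mathcomp Require Export complex.

Set Implicit Arguments.
Unset Strict Implicit.
Unset Printing Implicit Defensive.
Import Order.TTheory GRing.Theory Num.Theory.
Import numFieldNormedType.Exports.
Local Open Scope classical_set_scope.
Local Open Scope ring_scope.

Definition measure_rV_display : measure_display -> measure_display.
Proof. exact. Qed.

(* The sigma-algebra on row vectors generated by the coordinates, as in the
   library for n.-tuple T. *)
Section rV_measurable.
Context {d} {T : sigmaRingType d} (n : nat).

Let coors : 'I_n -> 'rV[T]_n -> T := fun i x => x ord0 i.

Let rV_set0 : g_sigma_preimage coors set0.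
Proof. exact: sigma_algebra0. Qed.

Let rV_setC A : g_sigma_preimage coors A -> g_sigma_preimage coors (~` A).
Proof. exact: sigma_algebraC. Qed.

Let rV_bigcup (F : _^nat) : (forall i, g_sigma_preimage coors (F i)) ->
  g_sigma_preimage coors (\bigcup_i (F i)).
Proof. exact: sigma_algebra_bigcup. Qed.

HB.instance Definition _ := @isMeasurable.Build (measure_rV_display d)
  ('rV[T]_n) (g_sigma_preimage coors) rV_set0 rV_setC rV_bigcup.
End rV_measurable.

Lemma measurable_coord d (T : sigmaRingType d) n (i : 'I_n) :
  measurable_fun [set: 'rV[T]_n] (fun v => v ord0 i).
Proof.
move=> _ Y mY; rewrite setTI; apply: sub_sigma_algebra => /=.
rewrite -bigcup_seq/=; exists i => /=; first by rewrite mem_index_enum.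
by exists Y => //; rewrite setTI.
Qed.

Lemma measurable_fun_rVP d1 d2 (T1 : measurableType d1)
    (T2 : measurableType d2) n (f : T1 -> 'rV[T2]_n) :
  (forall i, measurable_fun [set: T1] (fun x => f x ord0 i)) ->
  measurable_fun [set: T1] f.
Proof.
move=> mf.
have prefS : g_sigma_preimage (fun i => (fun x : 'rV[T2]_n => x ord0 i) \o f)
    `<=` measurable.
  apply: smallest_sub; first exact: sigma_algebra_measurable.
  case: n => [|n] in f mf *; first by rewrite big_ord0.
  rewrite -bigcup_mkord_ord; apply: bigcup_sub => i Ii.
  by move=> A [B mB <-]; exact: mf.
by move=> _ A mA; apply: prefS; rewrite g_sigma_preimage_comp; exists A.
Qed.


Section lebesgueR.
Context {R : realType}.

(* lebesgue_measure lives on measurableTypeR R, whose measurable structure has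
   the same sets as, but another display than, the canonical one on R. *)
Definition lebesgueR : set R -> \bar R := @lebesgue_measure R.
Let lebesgueR0 : lebesgueR set0 = 0%E.
Proof. exact: measure0. Qed.
Let lebesgueR_ge0 A : (0 <= lebesgueR A)%E.
Proof. exact: measure_ge0. Qed.
Let lebesgueR_sigma_additive : semi_sigma_additive lebesgueR.
Proof. exact: (@measure_semi_sigma_additive _ _ _ (@lebesgue_measure R)). Qed.
HB.instance Definition _ := isMeasure.Build _ _ _ lebesgueR
  lebesgueR0 lebesgueR_ge0 lebesgueR_sigma_additive.
Let lebesgueR_sigma_finite : sigma_finite setT lebesgueR.
Proof. exact: (@sigma_finiteT _ _ _ (@lebesgue_measure R)). Qed.
HB.instance Definition _ := Measure_isSigmaFinite.Build _ _ _ lebesgueR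
  lebesgueR_sigma_finite.
End lebesgueR.

Section product_measure.
Context {R : realType}.
(* Bundles m1 \x m2: the canonical sigma-finite structure on product_measure1 is
   only inferred for subprobabilities. *)
Lemma product_sigma_finite d1 d2 (T1 : measurableType d1)
    (T2 : measurableType d2) (m1 : {sigma_finite_measure set T1 -> \bar R})
    (m2 : {sigma_finite_measure set T2 -> \bar R}) :
  sigma_finite setT (m1 \x m2)%E.
Proof.
have /sigma_finiteP[F [TF ndF Foo]] := sigma_finiteT m1.
have /sigma_finiteP[G [TG ndG Goo]] := sigma_finiteT m2.
exists (fun n => F n `*` G n).
  rewrite -setXTT TF TG predeqE => -[x y]; split.
    move=> [/= [n _ Fnx] [k _ Gky]]; exists (maxn n k) => //; split.
    - by move: x Fnx; exact/subsetPset/ndF/leq_maxl.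
    - by move: y Gky; exact/subsetPset/ndG/leq_maxr.
  by move=> [n _ []/= ? ?]; split; exists n.
move=> k; have [? ?] := Foo k; have [? ?] := Goo k.
split; first exact: measurableX.
by rewrite product_measure1E// lte_mul_pinfty// ge0_fin_numE.
Qed.

Definition sfprod d1 d2 (T1 : measurableType d1) (T2 : measurableType d2)
    (m1 : {sigma_finite_measure set T1 -> \bar R})
    (m2 : {sigma_finite_measure set T2 -> \bar R}) :
    {sigma_finite_measure set (T1 * T2)%type -> \bar R} :=
  HB.pack_for {sigma_finite_measure set (T1 * T2)%type -> \bar R}
    (product_measure1 m1 m2)
    (Measure_isSigmaFinite.Build _ _ _ (product_measure1 m1 m2)
      (product_sigma_finite m1 m2)).
End product_measure.

Section lebesgue_rV.
Context {R : realType}.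

Definition consrV n (p : R * 'rV[R]_n) : 'rV[R]_n.+1 :=
  row_mx (const_mx p.1 : 'rV_1) p.2.

Definition unconsrV n (v : 'rV[R]_n.+1) : R * 'rV[R]_n :=
  (v ord0 ord0, rsubmx (v : 'rV_(1 + n))).

Lemma consrVK n : cancel (@consrV n) (@unconsrV n).
Proof.
move=> [t v]; rewrite /consrV /unconsrV/= row_mxKr.
congr pair.
rewrite -[RHS](_ : row_mx (const_mx t : 'rV_1) v ord0 (lshift n ord0) = t).
  by congr (row_mx _ _ _ _); apply/val_inj.
by rewrite row_mxEl mxE.
Qed.

Lemma measurable_consrV n : measurable_fun setT (@consrV n).
Proof.
apply: measurable_fun_rVP => i; rewrite /consrV.
case: (split_ordP (i : 'I_(1 + n))) => j ->.
  have -> : (fun x : R * 'rV[R]_n =>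
      row_mx (const_mx x.1 : 'rV[R]_1) x.2 ord0 (lshift n j)) = fst.
    by apply: funext => x; rewrite row_mxEl mxE.
  exact: measurable_fst.
have -> : (fun x : R * 'rV[R]_n =>
    row_mx (const_mx x.1 : 'rV[R]_1) x.2 ord0 (rshift 1 j)) =
    (fun v : 'rV[R]_n => v ord0 j) \o snd.
  by apply: funext => x; rewrite row_mxEr.
by apply: measurableT_comp; [exact: measurable_coord|exact: measurable_snd].
Qed.

Lemma measurable_unconsrV n : measurable_fun setT (@unconsrV n).
Proof.
apply/measurable_fun_pairP; split; first exact: measurable_coord.
apply: measurable_fun_rVP => i /=.
under eq_fun do rewrite mxE.
exact: measurable_coord.
Qed.

Section step.
Context n (m : {sigma_finite_measure set 'rV[R]_n -> \bar R}).

Definition lebesgue_consrV : set 'rV[R]_n.+1 -> \bar R :=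
  pushforward (lebesgueR \x m)%E (@consrV n).

HB.instance Definition _ := Measure.copy lebesgue_consrV
  (measure_function_pushforward__canonical__measure_function_Measure
    (lebesgueR \x m)%E (@measurable_consrV n)).

Let lebesgue_consrV_sigma_finite : sigma_finite setT lebesgue_consrV.
Proof.
have [F FT Foo] := product_sigma_finite lebesgueR m.
exists (fun k => @unconsrV n @^-1` F k).
  by rewrite -preimage_bigcup -FT preimage_setT.
move=> k; have [mF Fk] := Foo k; split.
  by rewrite -[X in measurable X]setTI; exact: measurable_unconsrV.
rewrite /lebesgue_consrV /pushforward -comp_preimage.
rewrite (_ : @unconsrV n \o _ = id)//.
by apply: funext => p; exact: consrVK.
Qed.

HB.instance Definition _ :=
  Measure_isSigmaFinite.Build _ _ _ lebesgue_consrV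
    lebesgue_consrV_sigma_finite.
End step.

(* Lebesgue measure on R^n, as the n-fold product of Lebesgue measure on R. *)
Fixpoint lebesgue_rV n : {sigma_finite_measure set 'rV[R]_n -> \bar R} :=
  if n is n'.+1 then lebesgue_consrV (lebesgue_rV n') else \d_(0 : 'rV[R]_0).
End lebesgue_rV.

Section complex_L2.
Context {R : realType} {d} {T : measurableType d}.
Variable mu : {measure set T -> \bar R}.
Local Notation C := R[i].
Local Open Scope complex_scope.

Definition cintegral (f : T -> C) : C :=
  (\int[mu]_z complex.Re (f z)) +i* (\int[mu]_z complex.Im (f z)).

(* Square-integrable representatives; elements of L^2 are their classes modulo
   equality almost everywhere. *)
Definition is_L2 (f : T -> C) : Prop :=
  [/\ measurable_fun setT (fun z => complex.Re (f z)),
      measurable_fun setT (fun z => complex.Im (f z)) &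
      (\int[mu]_z (complex.Re (f z) ^+ 2 + complex.Im (f z) ^+ 2)%:E < +oo)%E].

Definition inner (f g : T -> C) : C := cintegral (fun z => f z * conjc (g z)).

(* For A bounded on L^2, adjoint A g is a representative of the class A^* g. *)
Definition adjoint (A : (T -> C) -> T -> C) (g : T -> C) : T -> C :=
  xget (fun=> 0)
    [set h | is_L2 h /\ forall f, is_L2 f -> inner (A f) g = inner f h].

(* Equality of two operators, given on representatives, as maps L^2 -> L^2. *)
Definition eq_operator (A B : (T -> C) -> T -> C) : Prop :=
  forall f, is_L2 f ->
    [/\ is_L2 (A f), is_L2 (B f) & {ae mu, forall z, A f z = B f z}].

End complex_L2.

Section schwartz.
Context {R : realType}.

Definition iter_derive (E : normedModType R) (vs : seq E) (f : E -> R) :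
    E -> R :=
  foldr (fun v g => 'D_v g) f vs.

(* All iterated directional derivatives exist, are differentiable, and decay
   faster than any power of the norm; Schwartz class when E has finite
   dimension. *)
Definition schwartz (E : normedModType R) (f : E -> R) : Prop :=
  forall vs : seq E,
    (forall z, differentiable (iter_derive vs f) z) /\
    forall k : nat, exists M : R,
      forall z, `|z| ^+ k * `|iter_derive vs f z| <= M.

Definition pt n : Type := ('rV[R]_n * 'rV[R]_n * R)%type.

(* Complex Schwartz functions of (x, y, r) with compact support in r. *)
Definition schwartz_csupp n (f : pt n -> R[i]) : Prop :=
  [/\ schwartz (fun z : pt n => complex.Re (f z)), schwartz (fun z : pt n => complex.Im (f z)) &
      exists M : R, forall x y r, M < `|r| -> f (x, y, r) = 0].

End schwartz.
Arguments pt R n : clear implicits.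

Section double.
Context {R : realType} (n : nat) (lam : R).
Local Notation C := R[i].
Local Notation V := 'rV[R]_n.
Local Notation X := (pt R n).
Local Open Scope complex_scope.
Implicit Types (phi f psi g : X -> C) (F xi : X * X -> C).

Definition lebesgue_pt : {sigma_finite_measure set X -> \bar R} :=
  sfprod (sfprod (lebesgue_rV n) (lebesgue_rV n)) lebesgueR.

Definition lebesgue_pt2 : {sigma_finite_measure set (X * X)%type -> \bar R} :=
  sfprod lebesgue_pt lebesgue_pt.

Definition beta (x y : V) : R := \sum_i x ord0 i * y ord0 i.

Definition e (t : R) : C := cos (2 * pi * t) +i* sin (2 * pi * t).

Definition ebar (t : R) : C := e (- t).

Definition eta (r : R) : R :=
  if lam == 0 then r else (expR (2 * lam * r) - 1) / (2 * lam).

Local Notation E r := (expR (lam * r)).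

Definition Zop xi : X * X -> C := fun '((x, y, r), (x', y', r')) =>
  (E r ^+ n)%:C
  * ebar (eta r * beta (E r' *: x') (y - E r' *: y'))
  * e (eta r * beta (x - E r' *: x') y')
  * xi ((x - E r' *: x' + x', y - E r' *: y' + y', r),
        (E r *: x', E r *: y', r')).

Definition Lop f (xi : X -> C) : X -> C := fun '(x, y, r) =>
  cintegral (sfprod (lebesgue_rV n) (lebesgue_rV n)) (fun '(xt, yt) =>
    f (xt, yt, r) * xi (x - xt, y - yt, r) * ebar (eta r * beta xt (y - yt))).

Definition lambdaop phi (xi : X -> C) : X -> C := fun '(x, y, r) =>
  cintegral lebesgueR (fun rt =>
    phi (E rt *: x, E rt *: y, r - rt) * xi (x, y, rt)).

(* The operators 1 (x) a and b (x) 1 on L^2(X x X) = L^2(X) (x) L^2(X), acting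
   on slices. *)
Definition tensor1l (a : (X -> C) -> X -> C) xi : X * X -> C :=
  fun p => a (fun q => xi (p.1, q)) p.2.

Definition tensor1r (b : (X -> C) -> X -> C) xi : X * X -> C :=
  fun p => b (fun q => xi (q, p.2)) p.1.

Definition pi_rep (a : (X -> C) -> X -> C) xi : X * X -> C :=
  Zop (tensor1l a (adjoint lebesgue_pt2 Zop xi)).

Definition pi'_rep (b : (X -> C) -> X -> C) xi : X * X -> C := tensor1r b xi.

Definition Pi_tensor phi f xi : X * X -> C :=
  pi'_rep (lambdaop phi) (pi_rep (Lop f) xi).

Definition phase (x y y' : V) (r' : R) (xt yt : V) (rt : R) : C :=
  ebar (eta r' * beta (E (- rt) *: xt) y')
  * e (eta rt * beta x (E (- rt) *: yt))
  * ebar (eta rt * beta (E (r' - rt) *: xt) y)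
  * e (eta r' * beta xt yt)
  * e (eta rt * beta (E (- rt) *: xt) (E (- rt) *: yt))
  * ebar (eta rt * beta (E (r' - rt) *: xt) (E (- rt) *: yt)).

(* The integral formula is written for every function F; it is the operator Pi(F)
   when F is a Schwartz function with compact support in r and r'. *)
Definition Pi F xi : X * X -> C := fun '((x, y, r), (x', y', r')) =>
  cintegral lebesgue_pt (fun '(xt, yt, rt) =>
    F ((E rt *: x, E rt *: y, r - rt), (xt, yt, r'))
    * phase x y y' r' xt yt rt
    * xi ((x - E (r' - rt) *: xt + E (- rt) *: xt,
           y - E (r' - rt) *: yt + E (- rt) *: yt, rt),
          (x' - E (- rt) *: xt, y' - E (- rt) *: yt, r'))).

(* The product of the elementary tensors phi (x) f and psi (x) g. *)
Definition mul_tensor phi f psi g : X * X -> C :=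
  fun '((x, y, r), (x', y', r')) =>
  cintegral lebesgue_pt (fun '(xt, yt, rt) =>
    phi (E rt *: x, E rt *: y, r - rt)
    * psi (x - E (r' - rt) *: xt + E (- rt) *: xt,
           y - E (r' - rt) *: yt + E (- rt) *: yt, rt)
    * phase x y y' r' xt yt rt
    * f (xt, yt, r')
    * g (x' - E (- rt) *: xt, y' - E (- rt) *: yt, r')).

End double.

(* Main.v *)
From HB Require Import structures.
From mathcomp Require Import all_boot all_order all_algebra.
From mathcomp Require Import all_classical all_reals all_analysis measurable_realfun.
From mathcomp Require Import ring lra.
Require Import Defs.

Set Implicit Arguments.
Unset Strict Implicit.
Unset Printing Implicit Defensive.
Import Order.TTheory GRing.Theory Num.Theory.
Import numFieldNormedType.Exports.
Local Open Scope classical_set_scope.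
Local Open Scope ring_scope.

(** The operators L_f, lambda_phi and Pi(F) have the form
    (A xi)(w) = int K(w, u) xi(S(w, u)) du, where w ranges over the pairs of points
    (x, y, r; x', y', r') and S displaces w along u. Once this is known for
    Pi(phi (x) f), with u = (rt, q) and a kernel given by an explicit phase, the
    product Pi(phi (x) f) Pi(psi (x) g) is an integral over two displacements
    (r1, q1), (r3, q3). The substitution r1 = r2 + rt, r3 = rt,
    q3 = qt - e^(- lam r2) q2, q1 = q2 preserves Lebesgue measure and turns the
    composite displacement into the single displacement (qt, rt) of Pi; the two
    phases multiply to the phase of Pi at (qt, rt) times the phase of the twisted
    product at (q2, r2) (angle_cocycle), and integrating over (q2, r2) first leaves
    Pi of the twisted product.

    The analysis consists in justifying Fubini almost everywhere. All kernels satisfy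
    a Schur test (schur_bounded): they are dominated by some k >= 0 whose integral in u
    is bounded uniformly in w, while int int k(w, u) h(S(w, u)) <= c int h for every
    h >= 0. Such operators preserve L^2 (is_L2_int_op), depend only on the class of xi
    (ae_eq_int_op), converge absolutely for almost every w
    (ae_cintegrable_int_op), and compose by Fubini (int_op_comp). For L_f the
    dominating function comes from the decay of f, for lambda_phi from its boundedness
    and compact support in r. The column bound holds for L_f because its displacements
    are shears, which preserve Lebesgue measure, and for lambda_phi by integrating the
    dominating function over the height of w.

    The representation pi(L_f) = Z (1 (x) L_f) Z^* involves the adjoint of Z, which is
    only determined up to null sets: it is almost everywhere the explicit inverse Zinv
    (adjoint_Zop), by the change of variables w |-> flowZ w and the uniqueness of
    adjoints (adjoint_ae_eq). Conjugating the phase of L_f by that of Z gives the phase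
    of Pi (angle_conj_Z). Both phase identities reduce to the bilinearity of beta, the
    addition law of eta and the symmetry of eta(r) (e^(2 lam s) - 1) in r and s. *)

(** * Lebesgue measure under affine maps *)

Section affine_lebesgueR.
Context {R : realType}.
Variables (a b : R).
Hypothesis a0 : 0 < a.

Let aff (x : R) : R := a * x + b.

Let maff : measurable_fun setT aff.
Proof. by apply: measurable_funD => //; exact: measurable_funM. Qed.

(* The image measure is needed twice: on R, where integrals are taken, and on the
   copy of R for which Lebesgue measure is characterised by its values on half-open
   intervals. *)
Let pf : {measure set R -> \bar R} :=
  measure_function_pushforward__canonical__measure_function_Measure
    (@lebesgueR R) maff.
Let img' : {measure set R -> \bar R} := mscale (NngNum (ltW a0)) pf.
Let img : set (measurableTypeR R) -> \bar R := img'.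

Let img0 : img set0 = 0%E.
Proof. exact: (measure0 img'). Qed.
Let img_ge0 A : (0 <= img A)%E.
Proof. exact: (measure_ge0 img'). Qed.
Let img_add : semi_sigma_additive img.
Proof. exact: (@measure_semi_sigma_additive _ _ _ img'). Qed.
HB.instance Definition _ := isMeasure.Build _ _ _ img img0 img_ge0 img_add.

Let imgE A : measurable A -> @lebesgueR R A = img' A.
Proof.
move=> mA; have := @lebesgue_measure_unique R img _ A mA; apply => X.
case=> -[u v] _ <-/=.
transitivity (a%:E * lebesgue_measure (aff @^-1` `]u, v]%classic))%E; last by [].
rewrite (_ : aff @^-1` _ = `](u - b) / a, (v - b) / a]%classic); last first.
  apply/seteqP; split => x /=; rewrite !in_itv/= /aff;
  by rewrite ltr_pdivrMr// ler_pdivlMr// ltrBlDr lerBrDr [x * a]mulrC.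
rewrite !lebesgue_measure_itv/= !lte_fin ltr_pM2r ?invr_gt0// ltrD2r.
case: ifPn => _; last by rewrite mule0.
by rewrite -!EFinD -EFinM; congr EFin; field; exact: lt0r_neq0.
Qed.

Lemma lebesgueR_affine (G : R -> \bar R) : measurable_fun setT G ->
  (forall x, 0 <= G x)%E ->
  (a%:E * \int[lebesgueR]_x G (a * x + b)%R = \int[lebesgueR]_x G x)%E.
Proof.
move=> mG G0; rewrite [RHS](eq_measure_integral img'); last first.
  by move=> A mA _; exact: imgE.
rewrite ge0_integral_mscale//; congr (_ * _)%E.
by rewrite ge0_integral_pushforward.
Qed.
End affine_lebesgueR.

Lemma lebesgueR_shift {R : realType} (b : R) (G : R -> \bar R) : measurable_fun setT G ->
  (forall x, 0 <= G x)%E -> (\int[lebesgueR]_x G (x + b)%R = \int[lebesgueR]_x G x)%E.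
Proof.
move=> mG G0; rewrite -(lebesgueR_affine b (@ltr01 R) mG G0) mul1e.
by apply: eq_integral => x _; rewrite mul1r.
Qed.

Section affine_lebesgue_rV.
Context {R : realType}.

Lemma consrV_unconsrV n (v : 'rV[R]_n.+1) : consrV (unconsrV v) = v.
Proof.
rewrite /consrV /unconsrV/=; apply/rowP => i.
case: (split_ordP (i : 'I_(1 + n))) => j ->.
  rewrite (@row_mxEl _ 1 1 n) mxE; congr (v _ _).
  by apply/val_inj; rewrite /= (ord1 j).
by rewrite (@row_mxEr _ 1 1 n) mxE.
Qed.

Lemma consrV_affine n (c : R) (p q : R * 'rV[R]_n) :
  c *: consrV p + consrV q = consrV (c * p.1 + q.1, c *: p.2 + q.2).
Proof.
apply/rowP => i; rewrite !mxE.
by case: (fintype.split _) => j; rewrite !mxE.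
Qed.

Lemma measurable_rV_affine n (c : R) (b : 'rV[R]_n) :
  measurable_fun setT (fun x : 'rV[R]_n => c *: x + b).
Proof.
apply: measurable_fun_rVP => i.
under eq_fun do rewrite !mxE.
apply: measurable_funD => //; apply: measurable_funM => //.
exact: measurable_coord.
Qed.

Lemma ge0_integral_lebesgue_rVS n (G : 'rV[R]_n.+1 -> \bar R) :
  measurable_fun setT G -> (forall x, 0 <= G x)%E ->
  (\int[lebesgue_rV n.+1]_x G x =
   \int[lebesgueR]_t \int[lebesgue_rV n]_v G (consrV (t, v)))%E.
Proof.
move=> mG G0.
rewrite [LHS](_ : _ = \int[pushforward (lebesgueR \x lebesgue_rV n)%E (@consrV R n)]_x G x)%E//.
rewrite ge0_integral_pushforward//; last exact: measurable_consrV.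
rewrite fubini_tonelli1//; last by move=> x; exact: G0.
by apply: measurableT_comp => //; exact: measurable_consrV.
Qed.

Lemma lebesgue_rV_affine n (c : R) (b : 'rV[R]_n) (G : 'rV[R]_n -> \bar R) :
  0 < c -> measurable_fun setT G -> (forall x, 0 <= G x)%E ->
  ((c ^+ n)%:E * \int[lebesgue_rV n]_x G (c *: x + b)%R =
   \int[lebesgue_rV n]_x G x)%E.
Proof.
move=> c0; elim: n => [|n IH] in b G *; move=> mG G0.
  rewrite expr0 mul1e; apply: eq_integral => x _; congr G.
  by rewrite (thinmx0 x) (thinmx0 (_ + _)).
rewrite !ge0_integral_lebesgue_rVS//; last first.
  by apply: measurableT_comp => //; exact: measurable_rV_affine.
have mGc : measurable_fun setT (G \o @consrV R n).
  by apply: measurableT_comp => //; exact: measurable_consrV.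
pose H t := (\int[lebesgue_rV n]_v G (consrV (t, v)))%E.
have mH : measurable_fun setT H 
  by apply: (measurable_fun_fubini_tonelli_F (G \o @consrV R n)) => // x; exact: G0.
have H0 t : (0 <= H t)%E by apply: integral_ge0.
have mGt t : measurable_fun setT (fun v => G (consrV (t, v))).
  by apply: measurableT_comp => //; apply: measurableT_comp; [exact: measurable_consrV|exact: measurable_pair1].
rewrite -(lebesgueR_affine (unconsrV b).1 c0 mH H0) exprS EFinM -muleA; congr (_ * _)%E.
rewrite -ge0_integralZl//; last 3 first.
- apply: (measurable_fun_fubini_tonelli_F (fun p => G (c *: consrV p + b)%R)) => //.
  apply: (measurableT_comp mG); apply: (measurableT_comp (measurable_rV_affine c b)).
  exact: measurable_consrV.
- by move=> t _; exact: integral_ge0.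
- by rewrite lee_fin exprn_ge0// ltW.
apply: eq_integral => t _.
rewrite -[RHS](IH (unconsrV b).2)//; congr (_ * _)%E; apply: eq_integral => v _.
by rewrite -{1}(consrV_unconsrV b) consrV_affine.
Qed.

End affine_lebesgue_rV.

Notation Q R n := ('rV[R]_n * 'rV[R]_n)%type.

Section measurable_vectors.
Context {R : realType} {n : nat} {d} {T : measurableType d}.
Implicit Types (f g : T -> Q R n) (c : T -> R).

Lemma measurable_rVD (f g : T -> 'rV[R]_n) : measurable_fun setT f ->
  measurable_fun setT g -> measurable_fun setT (fun x => f x + g x).
Proof.
move=> mf mg; apply: measurable_fun_rVP => i; under eq_fun do rewrite mxE.
by apply: measurable_funD; apply: measurableT_comp (measurable_coord i) _.
Qed.

Lemma measurable_rVZ (c : T -> R) (f : T -> 'rV[R]_n) : measurable_fun setT c ->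
  measurable_fun setT f -> measurable_fun setT (fun x => c x *: f x).
Proof.
move=> mc mf; apply: measurable_fun_rVP => i; under eq_fun do rewrite mxE.
by apply: measurable_funM => //; apply: measurableT_comp (measurable_coord i) _.
Qed.

Lemma measurable_rVN (f : T -> 'rV[R]_n) : measurable_fun setT f ->
  measurable_fun setT (fun x => - f x).
Proof.
move=> mf; under eq_fun do rewrite -scaleN1r.
by apply: measurable_rVZ => //; exact: measurable_cst.
Qed.

Lemma measurable_QD f g : measurable_fun setT f -> measurable_fun setT g ->
  measurable_fun setT (fun x => f x + g x).
Proof.
move=> mf mg; apply/measurable_fun_pairP; split => /=;
  by apply: measurable_rVD; apply: measurableT_comp.
Qed.

Lemma measurable_QZ c f : measurable_fun setT c -> measurable_fun setT f ->
  measurable_fun setT (fun x => c x *: f x).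
Proof.
move=> mc mf; apply/measurable_fun_pairP; split => /=;
  by apply: measurable_rVZ => //; apply: measurableT_comp.
Qed.

Lemma measurable_QN f : measurable_fun setT f -> measurable_fun setT (fun x => - f x).
Proof.
move=> mf; apply/measurable_fun_pairP; split => /=;
  by apply: measurable_rVN; apply: measurableT_comp.
Qed.

Lemma measurable_beta (f g : T -> 'rV[R]_n) : measurable_fun setT f ->
  measurable_fun setT g -> measurable_fun setT (fun x => beta (f x) (g x)).
Proof.
move=> mf mg; apply: measurable_sum => i.
by apply: measurable_funM; apply: measurableT_comp (measurable_coord i) _.
Qed.

Lemma measurable_eta (lam : R) c : measurable_fun setT c ->
  measurable_fun setT (fun x => eta lam (c x)).
Proof.
move=> mc; rewrite /eta; case: eqP => // _.
apply: measurable_funM => //; apply: measurable_funB => //.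
by apply: (measurableT_comp (@measurable_expR R)); exact: measurable_funM.
Qed.
End measurable_vectors.

(** Directed by the head symbol of the function; the last case undoes the
    eta-contractions that unification performs. *)
Ltac measurability_step :=
  first
  [ assumption
  | match goal with
    | |- measurable_fun _ (fun x => x) => exact: measurable_id
    | |- measurable_fun _ (fun x => ?c) => exact: measurable_cst
    | |- measurable_fun _ (fun x => (_, _)) => apply: measurable_fun_pair
    | |- measurable_fun _ (fun x => fst (@?f x)) =>
        apply: (measurableT_comp (g := f) measurable_fst)
    | |- measurable_fun _ (fun x => snd (@?f x)) =>
        apply: (measurableT_comp (g := f) measurable_snd)
    | |- measurable_fun _ (fun x => expR (@?f x)) =>
        apply: (measurableT_comp (g := f) (@measurable_expR _))
    | |- measurable_fun _ (fun x => eta _ (@?f x)) => apply: measurable_eta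
    | |- measurable_fun _ (fun x => beta _ _) => apply: measurable_beta
    | |- measurable_fun _ (fun x => _ * _) => apply: measurable_funM
    | |- measurable_fun _ (fun x => _ ^+ _) => apply: measurable_funX
    | |- measurable_fun _ (fun x => _ *: _) =>
        first [apply: measurable_QZ | apply: measurable_rVZ]
    | |- measurable_fun _ (fun x => _ + _) =>
        first [apply: measurable_funD | apply: measurable_QD | apply: measurable_rVD]
    | |- measurable_fun _ (fun x => - _) =>
        first [apply: measurable_funN | apply: measurable_QN | apply: measurable_rVN]
    | |- measurable_fun ?D ?f =>
        lazymatch f with (fun _ => _) => fail | _ => change (measurable_fun D (fun x => f x)) end
    end ].
Ltac measurability := rewrite /=; repeat measurability_step.

Section shear.
Context {R : realType} (n : nat).
Local Notation muQ := (sfprod (@lebesgue_rV R n) (@lebesgue_rV R n)).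
Local Notation leb := (@lebesgueR R).

Lemma lebesgue_Q_affine (c : R) (b : Q R n) (G : Q R n -> \bar R) :
  0 < c -> measurable_fun setT G -> (forall x, 0 <= G x)%E ->
  (((c ^+ n) ^+ 2)%:E * \int[muQ]_x G (c *: x + b)%R = \int[muQ]_x G x)%E.
Proof.
move=> c0 mG G0.
have cn0 : (0 <= (c ^+ n)%:E)%E by rewrite lee_fin exprn_ge0// ltW.
rewrite [X in (_ * X)%E]fubini_tonelli1//; last first.
  by apply: (measurableT_comp mG); measurability.
rewrite [RHS]fubini_tonelli1// /fubini_F.
rewrite expr2 EFinM -muleA -ge0_integralZl//; last 2 first.
- apply: (measurable_fun_fubini_tonelli_F (fun p : Q R n => G (c *: p + b)%R)) => //.
  by apply: (measurableT_comp mG); measurability.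
- by move=> x _; exact: integral_ge0.
rewrite -(@lebesgue_rV_affine _ n c b.1 (fun x => \int[lebesgue_rV n]_y G (x, y))%E)//; last 2 first.
- exact: (measurable_fun_fubini_tonelli_F G).
- by move=> x; exact: integral_ge0.
congr (_ * _)%E; apply: eq_integral => x _.
rewrite -(@lebesgue_rV_affine _ n c b.2 (fun y => G (c *: x + b.1, y)))//.
by apply: (measurableT_comp mG); measurability.
Qed.

Lemma lebesgue_Q_shift (b : Q R n) (G : Q R n -> \bar R) :
  measurable_fun setT G -> (forall x, 0 <= G x)%E ->
  (\int[muQ]_x G (x + b)%R = \int[muQ]_x G x)%E.
Proof.
move=> mG G0; rewrite -(lebesgue_Q_affine b (@ltr01 R) mG G0) !expr1n mul1e.
by apply: eq_integral => x _; rewrite scale1r.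
Qed.

Lemma ge0_integral_pt (G : Q R n * R -> \bar R) : measurable_fun setT G ->
  (forall x, 0 <= G x)%E ->
  (\int[lebesgue_pt n]_p G p = \int[leb]_r \int[muQ]_z G (z, r))%E.
Proof. by move=> mG G0; rewrite fubini_tonelli2. Qed.

(** Outermost r, then r', then the planar blocks: every change of variables below acts
    on one planar block at a time once the heights r and r' are fixed. *)
Lemma ge0_integral_pt2 (G : pt R n * pt R n -> \bar R) : measurable_fun setT G ->
  (forall x, 0 <= G x)%E ->
  (\int[lebesgue_pt2 n]_w G w =
   \int[leb]_r \int[leb]_r' \int[muQ]_z' \int[muQ]_z G ((z, r), (z', r')))%E.
Proof.
move=> mG G0; rewrite fubini_tonelli1// ge0_integral_pt; last 2 first.
- exact: measurable_fun_fubini_tonelli_F.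
- by move=> x; exact: integral_ge0.
apply: eq_integral => r _.
transitivity (\int[muQ]_z \int[lebesgue_pt n]_p G ((z, r), p))%E; first by [].
rewrite (fubini_tonelli (fun q : Q R n * pt R n => G ((q.1, r), q.2)))//; last first.
  by apply: (measurableT_comp mG); measurability.
rewrite ge0_integral_pt//.
- apply: (measurable_fun_fubini_tonelli_G (fun q : Q R n * pt R n => G ((q.1, r), q.2))) => //.
  by apply: (measurableT_comp mG); measurability.
- by move=> x; exact: integral_ge0.
Qed.

(** For fixed heights the map is triangular in the two planar blocks: a translation
    of the first, of size depending on the second, and a dilation of the second, which
    accounts for the Jacobian c^(2n). *)
Lemma lebesgue_pt2_shear (b : R * (pt R n) -> Q R n) (c : R * R -> R)
    (d : R * R -> Q R n) (G : pt R n * pt R n -> \bar R) :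
  measurable_fun setT b -> measurable_fun setT c -> measurable_fun setT d ->
  (forall r, 0 < c r) -> measurable_fun setT G -> (forall x, 0 <= G x)%E ->
  (\int[lebesgue_pt2 n]_w (((c (w.1.2, w.2.2) ^+ n) ^+ 2)%:E *
      G ((w.1.1 + b (w.1.2, w.2), w.1.2),
         (c (w.1.2, w.2.2) *: w.2.1 + d (w.1.2, w.2.2), w.2.2))%R)
   = \int[lebesgue_pt2 n]_w G w)%E.
Proof.
move=> mb mc md c0 mG G0.
have mT (f : pt R n * pt R n -> R * pt R n) : measurable_fun setT f ->
   measurable_fun setT (fun w => b (f w)) by exact: measurableT_comp.
have cn0 r : (0 <= ((c r ^+ n) ^+ 2)%:E)%E by rewrite lee_fin sqr_ge0.
rewrite [RHS]ge0_integral_pt2// ge0_integral_pt2; last 2 first.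
- apply: emeasurable_funM => //.
    apply/measurable_EFinP; do 2 apply: measurable_funX.
    by apply: (measurableT_comp mc); measurability.
  apply: (measurableT_comp mG); measurability.
  + by apply: (measurableT_comp mb); measurability.
  + by apply: (measurableT_comp mc); measurability.
  + by apply: (measurableT_comp md); measurability.
- by move=> x; rewrite mule_ge0.
apply: eq_integral => r _; apply: eq_integral => r' _ /=.
have mG1 : measurable_fun setT (fun q : Q R n * Q R n => G ((q.2, r), (q.1, r'))).
  by apply: (measurableT_comp mG); measurability.
rewrite -(@lebesgue_Q_affine (c (r, r')) (d (r, r')) (fun z' => \int[muQ]_z G ((z, r), (z', r')))%E)//; last 2 first.
- exact: (measurable_fun_fubini_tonelli_F (fun q : Q R n * Q R n => G ((q.2, r), (q.1, r')))).
- by move=> x; exact: integral_ge0.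
rewrite -ge0_integralZl//; last 2 first.
- apply: (measurable_fun_fubini_tonelli_F (fun q : Q R n * Q R n => G ((q.2, r), (c (r, r') *: q.1 + d (r, r'), r')))) => //.
  by apply: (measurableT_comp mG); measurability.
- by move=> x _; exact: integral_ge0.
apply: eq_integral => z' _.
rewrite ge0_integralZl//.
  congr (_ * _)%E.
  rewrite (@lebesgue_Q_shift (b (r, (z', r'))) (fun z => G ((z, r), (c (r, r') *: z' + d (r, r'), r'))))//.
  by apply: (measurableT_comp mG); measurability.
by apply: (measurableT_comp mG); measurability.
Qed.

End shear.

(** * Complex-valued integrals *)

Section complex_functions.
Context {R : realType}.
Local Notation C := R[i].
Local Notation Re := complex.Re.
Local Notation Im := complex.Im.
Implicit Types (a b : C).

Lemma ReMc a b : Re (a * b) = Re a * Re b - Im a * Im b.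
Proof. by case: a b => ? ? [? ?]. Qed.

Lemma ImMc a b : Im (a * b) = Re a * Im b + Im a * Re b.
Proof. by case: a b => ? ? [? ?]. Qed.

Lemma ReDc a b : Re (a + b) = Re a + Re b.
Proof. by case: a b => ? ? [? ?]. Qed.

Lemma ImDc a b : Im (a + b) = Im a + Im b.
Proof. by case: a b => ? ? [? ?]. Qed.

Lemma ReNc a : Re (- a) = - Re a. Proof. by case: a. Qed.

Lemma ImNc a : Im (- a) = - Im a. Proof. by case: a. Qed.

Lemma eq_complexRI a b : Re a = Re b -> Im a = Im b -> a = b.
Proof. by case: a b => ? ? [? ?] /= -> ->. Qed.

Definition sqmod a : R := Re a ^+ 2 + Im a ^+ 2.

Lemma sqmod_ge0 a : 0 <= sqmod a.
Proof. by rewrite addr_ge0 ?sqr_ge0. Qed.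

Lemma sqmodM a b : sqmod (a * b) = sqmod a * sqmod b.
Proof. by rewrite /sqmod ReMc ImMc; ring. Qed.

Lemma sqrRe_le a : Re a ^+ 2 <= sqmod a.
Proof. by rewrite lerDl sqr_ge0. Qed.

Lemma sqrIm_le a : Im a ^+ 2 <= sqmod a.
Proof. by rewrite lerDr sqr_ge0. Qed.

(** The two estimates come from 2 t |b| <= |b|^2 + t^2, which spares square
    roots: only squared moduli occur below. *)
Lemma normRe_le_young (k t : R) a b : 0 <= k -> 0 <= t -> sqmod a <= k ^+ 2 ->
  2 * t * `|Re (a * b)| <= k * (sqmod b + t ^+ 2).
Proof.
move=> k0 t0 ak; have b0 := sqmod_ge0 b.
rewrite -ler_sqr ?nnegrE ?mulr_ge0 ?addr_ge0 ?sqr_ge0//.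
rewrite exprMn real_normK ?num_real//.
have h : Re (a * b) ^+ 2 <= k ^+ 2 * sqmod b.
  by rewrite (le_trans (sqrRe_le _))// sqmodM ler_wpM2r.
apply: (@le_trans _ _ ((2 * t) ^+ 2 * (k ^+ 2 * sqmod b))).
  by rewrite ler_wpM2l ?sqr_ge0.
rewrite -subr_ge0 (_ : _ - _ = (k * (sqmod b - t ^+ 2)) ^+ 2) ?sqr_ge0//.
by ring.
Qed.

Lemma normIm_le_young (k t : R) a b : 0 <= k -> 0 <= t -> sqmod a <= k ^+ 2 ->
  2 * t * `|Im (a * b)| <= k * (sqmod b + t ^+ 2).
Proof.
move=> k0 t0 ak.
rewrite (_ : Im (a * b) = Re ((- 'i%C * a) * b)); last first.
  by rewrite !ReMc !ImMc /=; ring.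
apply: normRe_le_young => //; rewrite sqmodM (_ : sqmod (- 'i%C) = 1) ?mul1r//.
by rewrite /sqmod/=; ring.
Qed.

Section measurable.
Context {d} {T : measurableType d}.
Implicit Types f g : T -> C.

Definition cmeasurable f :=
  measurable_fun setT (fun x => Re (f x)) /\ measurable_fun setT (fun x => Im (f x)).

Lemma cmeasurableM f g : cmeasurable f -> cmeasurable g ->
  cmeasurable (fun x => f x * g x).
Proof.
move=> [f1 f2] [g1 g2]; split.
  under eq_fun do rewrite ReMc.
  by apply: measurable_funB; exact: measurable_funM.
under eq_fun do rewrite ImMc.
by apply: measurable_funD; exact: measurable_funM.
Qed.

Lemma cmeasurableB f g : cmeasurable f -> cmeasurable g ->
  cmeasurable (fun x => f x - g x).
Proof.
move=> [f1 f2] [g1 g2]; split.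
  under eq_fun do rewrite ReDc ReNc.
  exact: measurable_funB.
under eq_fun do rewrite ImDc ImNc.
exact: measurable_funB.
Qed.

Lemma cmeasurable_conj f : cmeasurable f -> cmeasurable (fun x => conjc (f x)).
Proof.
move=> [f1 f2]; split.
  by rewrite (_ : (fun x => _) = fun x => Re (f x))//; apply: funext => x; case: (f x).
rewrite (_ : (fun x => _) = fun x => - Im (f x)); first exact: measurable_funN.
by apply: funext => x; case: (f x).
Qed.

Lemma cmeasurable_real (f : T -> R) : measurable_fun setT f ->
  cmeasurable (fun x => (f x)%:C%C).
Proof. by move=> mf; split => //=; exact: measurable_cst. Qed.

Lemma measurable_sqmod f : cmeasurable f -> measurable_fun setT (fun x => sqmod (f x)).
Proof.
by move=> [f1 f2]; apply: measurable_funD; exact: measurable_funX.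
Qed.

End measurable.

Lemma cmeasurable_comp d d' (T : measurableType d)
    (T' : measurableType d') (h : T' -> T) (f : T -> C) :
  cmeasurable f -> measurable_fun setT h -> cmeasurable (fun x => f (h x)).
Proof.
move=> [f1 f2] mh; split.
  exact: (measurableT_comp f1).
exact: (measurableT_comp f2).
Qed.

Lemma cmeasurable_e : cmeasurable (@e R).
Proof.
have m2 : measurable_fun setT (fun t : R => 2 * pi * t) by exact: measurable_funM.
split => /=.
  apply: (measurableT_comp _ m2); apply: continuous_measurable_fun.
  exact: continuous_cos.
apply: (measurableT_comp _ m2); apply: continuous_measurable_fun.
exact: continuous_sin.
Qed.

Lemma eD (s t : R) : e (s + t) = e s * e t.
Proof.
apply: eq_complexRI; rewrite ?ReMc ?ImMc /= mulrDr ?cosD// sinD.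
by ring.
Qed.

Lemma sqmod_e (t : R) : sqmod (e t) = 1.
Proof. by rewrite /sqmod /= cos2Dsin2. Qed.

Lemma conj_e (t : R) : conjc (e t) = e (- t).
Proof. by rewrite /conjc /e mulrN cosN sinN. Qed.

End complex_functions.

Section complex_integral.
Context {R : realType}.
Local Notation C := R[i].
Local Notation Re := complex.Re.
Local Notation Im := complex.Im.

Section one_measure.
Context {d} {T : measurableType d} (mu : {measure set T -> \bar R}).
Implicit Types f g : T -> C.

Definition cintegrable f :=
  mu.-integrable setT (fun x => (Re (f x))%:E) /\
  mu.-integrable setT (fun x => (Im (f x))%:E).

Lemma cintegrable_measurable f : cintegrable f -> cmeasurable f.
Proof.
by move=> [/measurable_int/measurable_EFinP f1 /measurable_int/measurable_EFinP f2].
Qed.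

Lemma eq_cintegral f g : f =1 g -> cintegral mu f = cintegral mu g.
Proof. by move=> fg; congr cintegral; exact: funext. Qed.

Lemma ae_eq_cintegral f g : cmeasurable f -> cmeasurable g ->
  {ae mu, forall x, f x = g x} -> cintegral mu f = cintegral mu g.
Proof.
move=> [f1 f2] [g1 g2] fg; apply: eq_complexRI => /=; congr fine;
  apply: ae_eq_integral => //; try exact/measurable_EFinP.
  by apply: filterS fg => x -> _.
by apply: filterS fg => x -> _.
Qed.

Lemma cintegrableZ a f : cintegrable f -> cintegrable (fun x => a * f x).
Proof.
move=> [f1 f2]; split.
  under eq_fun do rewrite ReMc EFinB !EFinM.
  by apply: integrableB => //; exact: integrableZl.
under eq_fun do rewrite ImMc EFinD !EFinM.
by apply: integrableD => //; exact: integrableZl.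
Qed.

Lemma cintegralZ_integrable a f : cintegrable f ->
  cintegral mu (fun x => a * f x) = a * cintegral mu f.
Proof.
move=> [f1 f2]; apply: eq_complexRI; rewrite ?ReMc ?ImMc /=.
  under eq_Rintegral do rewrite ReMc.
  rewrite RintegralB//; last 2 first.
    exact: (integrableZl measurableT (Re a) f1).
    exact: (integrableZl measurableT (Im a) f2).
  by rewrite !RintegralZl.
under eq_Rintegral do rewrite ImMc.
rewrite RintegralD//; last 2 first.
  exact: (integrableZl measurableT (Re a) f2).
  exact: (integrableZl measurableT (Im a) f1).
by rewrite !RintegralZl.
Qed.

(** Integrability is only asked of the product: for a = 0 both sides vanish even
    if f is not integrable, and otherwise a can be divided out. *)
Lemma cintegralZ a f : cintegrable (fun x => a * f x) ->
  cintegral mu (fun x => a * f x) = a * cintegral mu f.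
Proof.
have [-> _|a0 iaf] := eqVneq a 0.
  rewrite mul0r; under eq_fun do rewrite mul0r.
  by apply: eq_complexRI; rewrite /= Rintegral_cst// mul0r.
apply: cintegralZ_integrable.
have := cintegrableZ a^-1 iaf.
by congr cintegrable; apply: funext => x; rewrite mulKf.
Qed.

Lemma cintegrable_le f (k : T -> R) : cmeasurable f ->
  mu.-integrable setT (fun x => (k x)%:E) ->
  (forall x, `|Re (f x)| <= k x) -> (forall x, `|Im (f x)| <= k x) ->
  cintegrable f.
Proof.
move=> [f1 f2] ik rk lk; split; apply: (le_integrable _ _ _ ik) => //;
  try exact/measurable_EFinP.
  by move=> x _; rewrite /= lee_fin (le_trans (rk x))// ler_norm.
by move=> x _; rewrite /= lee_fin (le_trans (lk x))// ler_norm.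
Qed.

Lemma cintegralB f g : cintegrable f -> cintegrable g ->
  cintegral mu (fun x => f x - g x) = cintegral mu f - cintegral mu g.
Proof.
move=> [f1 f2] [g1 g2]; apply: eq_complexRI; rewrite ?ReDc ?ReNc ?ImDc ?ImNc/=.
  by under eq_Rintegral do rewrite ReDc ReNc; rewrite RintegralB.
by under eq_Rintegral do rewrite ImDc ImNc; rewrite RintegralB.
Qed.

End one_measure.

Section two_measures.
Context {d1 d2} {T1 : measurableType d1} {T2 : measurableType d2}.
Variables (m1 : {sigma_finite_measure set T1 -> \bar R})
          (m2 : {sigma_finite_measure set T2 -> \bar R}).

Lemma measurable_Rintegral_param (f : T1 * T2 -> R) : measurable_fun setT f ->
  measurable_fun setT (fun x => \int[m2]_y f (x, y)).
Proof.
move=> mf; rewrite /Rintegral.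
have mF : measurable_fun setT (EFin \o f) by exact/measurable_EFinP.
apply: (measurableT_comp (@fine_measurable R setT measurableT)).
under eq_fun do rewrite integralE.
apply: emeasurable_funB.
- under eq_fun do under eq_integral do rewrite funeposE.
  apply: (measurable_fun_fubini_tonelli_F (fun p => maxe (f p)%:E 0)) => [|p].
    exact: measurable_maxe.
  by rewrite le_max lexx orbT.
- under eq_fun do under eq_integral do rewrite funenegE.
  apply: (measurable_fun_fubini_tonelli_F (fun p => maxe (- (f p)%:E) 0)%E) => [|p].
    by apply: measurable_maxe => //; exact: (measurableT_comp (f := oppe)).
  by rewrite le_max lexx orbT.
Qed.

Lemma cmeasurable_cintegral (f : T1 * T2 -> C) : cmeasurable f ->
  cmeasurable (fun x => cintegral m2 (fun y => f (x, y))).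
Proof.
move=> [f1 f2]; split => /=.
  exact: (measurable_Rintegral_param f1).
exact: (measurable_Rintegral_param f2).
Qed.

Lemma ae_cintegrable1 (f : T1 * T2 -> C) : cintegrable (sfprod m1 m2) f ->
  {ae m1, forall x, cintegrable m2 (fun y => f (x, y))}.
Proof.
move=> [f1 f2]; have := ae_integrable1 f1; have := ae_integrable1 f2.
by apply: filterS2 => x.
Qed.

(** The inner integral takes the value 0 where it diverges, which by integrability
    happens on a null set only. *)
Lemma Rintegral_fubini (f : T1 * T2 -> R) :
  (sfprod m1 m2).-integrable setT (EFin \o f) ->
  \int[m1]_x \int[m2]_y f (x, y) = \int[sfprod m1 m2]_p f p.
Proof.
move=> fi; have mf : measurable_fun setT f.
  by apply/measurable_EFinP; exact: measurable_int fi.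
rewrite {1 3}/Rintegral -[in RHS](integral12_prod_meas1 fi)/=; congr fine.
have [N [mN N0 HN]] := ae_integrable1 fi.
apply: ae_eq_integral => //.
- apply/measurable_EFinP; exact: (measurable_Rintegral_param mf).
- exact: (measurable_fubini_F fi).
- exists N; split => // x /= /not_implyP[_ h]; apply: HN => /= hi; apply: h.
  by rewrite /Rintegral fineK//; exact: integrable_fin_num hi.
Qed.

Lemma cintegral_fubini (f : T1 * T2 -> C) : cintegrable (sfprod m1 m2) f ->
  cintegral m1 (fun x => cintegral m2 (fun y => f (x, y))) =
  cintegral (sfprod m1 m2) f.
Proof.
move=> [f1 f2]; apply: eq_complexRI => /=.
  exact: (Rintegral_fubini f1).
exact: (Rintegral_fubini f2).
Qed.

End two_measures.

End complex_integral.

Section preserving_maps.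
Context {R : realType} {d1 d2} {A : measurableType d1} {B : measurableType d2}.
Variables (mA : {measure set A -> \bar R}) (mB : {measure set B -> \bar R}).
Variable sigma : A -> B.
Hypothesis msigma : measurable_fun setT sigma.
Hypothesis pres : forall G : B -> \bar R, measurable_fun setT G ->
  (forall b, 0 <= G b)%E -> (\int[mA]_a G (sigma a) = \int[mB]_b G b)%E.

Let integrable_preserving (f : B -> \bar R) :
  mB.-integrable setT f -> mA.-integrable setT (fun a => f (sigma a)).
Proof.
move=> /integrableP[mf foo]; apply/integrableP; split.
  exact: (measurableT_comp mf).
by rewrite (pres (G := fun b => `|f b|%E))//; exact: measurableT_comp.
Qed.

Let Rintegral_preserving (f : B -> R) : measurable_fun setT f ->
  \int[mA]_a f (sigma a) = \int[mB]_b f b.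
Proof.
move=> mf; have mfE : measurable_fun setT (EFin \o f) by exact/measurable_EFinP.
rewrite /Rintegral; congr fine; rewrite integralE [in RHS]integralE.
rewrite -(pres (measurable_funepos mfE) (funepos_ge0 _)).
rewrite -(pres (measurable_funeneg mfE) (funeneg_ge0 _)).
by congr (_ - _)%E; apply: eq_integral => a _; rewrite ?funeposE ?funenegE.
Qed.

Lemma cintegrable_preserving (f : B -> R[i]) : cintegrable mB f ->
  cintegrable mA (fun a => f (sigma a)).
Proof.
move=> [f1 f2]; split.
  exact: (integrable_preserving f1).
exact: (integrable_preserving f2).
Qed.

Lemma cintegral_preserving (f : B -> R[i]) : cmeasurable f ->
  cintegral mA (fun a => f (sigma a)) = cintegral mB f.
Proof.
move=> [f1 f2]; apply: eq_complexRI => /=.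
  exact: (Rintegral_preserving f1).
exact: (Rintegral_preserving f2).
Qed.
End preserving_maps.

(** * Integral operators satisfying a Schur bound *)

Section schur.
Context {R : realType} {dW dU} {W : measurableType dW} {U : measurableType dU}.
Variables (mu : {sigma_finite_measure set W -> \bar R})
          (nu : {sigma_finite_measure set U -> \bar R}).
Local Notation C := R[i].
Local Notation Re := complex.Re.
Local Notation Im := complex.Im.

(** The kernel depends on a displacement u of w rather than on a second point of W:
    the points S (w, u) reached from a given w form a null set in the cases of
    interest, so that there is no integral kernel on W x W. *)
Definition int_op (K : W * U -> C) (S : W * U -> W) (xi : W -> C) : W -> C :=
  fun w => cintegral nu (fun u => K (w, u) * xi (S (w, u))).

(** The two bounds of the Schur test for a dominating kernel k. Since the operator
    integrates along displacements, the bound by columns is stated by duality, against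
    an arbitrary h >= 0. *)
Record schur_bounded (K : W * U -> C) (S : W * U -> W) (k : W * U -> R)
    (c1 c2 : R) : Prop := SchurBounded {
  schur_mK : cmeasurable K;
  schur_mS : measurable_fun setT S;
  schur_mk : measurable_fun setT k;
  schur_k_ge0 : forall p, 0 <= k p;
  schur_dom : forall p, sqmod (K p) <= k p ^+ 2;
  schur_c1 : 0 < c1;
  schur_c2 : 0 <= c2;
  schur_row : forall w, (\int[nu]_u (k (w, u))%:E <= c1%:E)%E;
  schur_col : forall h : W -> \bar R, measurable_fun setT h ->
    (forall x, 0 <= h x)%E ->
    (\int[mu]_w \int[nu]_u ((k (w, u))%:E * h (S (w, u)))
      <= c2%:E * \int[mu]_w h w)%E }.

Lemma is_L2_measurable (xi : W -> C) : is_L2 mu xi -> cmeasurable xi.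
Proof. by case. Qed.

Variables (K : W * U -> C) (S : W * U -> W) (k : W * U -> R) (c1 c2 : R).
Hypothesis KSk : schur_bounded K S k c1 c2.

Let mK := schur_mK KSk.
Let mS := schur_mS KSk.
Let mk := schur_mk KSk.
Let k_ge0 := schur_k_ge0 KSk.
Let dom := schur_dom KSk.

Let msec (xi : W -> R) w : measurable_fun setT xi ->
  measurable_fun setT (fun u => xi (S (w, u))).
Proof.
move=> mxi; apply: (measurableT_comp mxi); apply: (measurableT_comp mS).
exact: measurable_pair1.
Qed.

Let mksec w : measurable_fun setT (fun u => k (w, u)).
Proof. by apply: (measurableT_comp mk); exact: measurable_pair1. Qed.

Lemma int_op_integrand_measurable (xi : W -> C) : cmeasurable xi ->
  cmeasurable (fun p => K p * xi (S p)).
Proof. by move=> mxi; apply: cmeasurableM => //; exact: cmeasurable_comp mS. Qed.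

Lemma cmeasurable_int_op (xi : W -> C) : cmeasurable xi -> cmeasurable (int_op K S xi).
Proof.
move=> mxi; apply: (cmeasurable_cintegral nu (f := fun p => K p * xi (S p))).
exact: int_op_integrand_measurable.
Qed.

Let integrable_k w : nu.-integrable setT (fun u => (k (w, u))%:E).
Proof.
apply/integrableP; split; first exact/measurable_EFinP.
under eq_integral do rewrite gee0_abs ?lee_fin//.
by rewrite (le_lt_trans (schur_row KSk w))// ltry.
Qed.

Let B (xi : W -> C) w : \bar R :=
  (\int[nu]_u (k (w, u) * sqmod (xi (S (w, u))))%:E)%E.

Let B_ge0 xi w : (0 <= B xi w)%E.
Proof. by apply: integral_ge0 => u _; rewrite lee_fin mulr_ge0 ?sqmod_ge0. Qed.

Let mB xi : cmeasurable xi -> measurable_fun setT (B xi).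
Proof.
move=> mxi; apply: (measurable_fun_fubini_tonelli_F (fun p => (k p * sqmod (xi (S p)))%:E)).
  apply/measurable_EFinP; apply: measurable_funM => //.
  by apply: (measurableT_comp (measurable_sqmod mxi)).
by move=> p; rewrite lee_fin mulr_ge0 ?sqmod_ge0.
Qed.

Let B_le xi : cmeasurable xi ->
  (\int[mu]_w B xi w <= c2%:E * \int[mu]_w (sqmod (xi w))%:E)%E.
Proof.
move=> mxi; apply: (schur_col KSk (h := fun w => (sqmod (xi w))%:E)).
  by apply/measurable_EFinP; exact: measurable_sqmod.
by move=> x; rewrite lee_fin sqmod_ge0.
Qed.

Let integrable_B xi w : cmeasurable xi -> (B xi w < +oo)%E ->
  nu.-integrable setT (fun u => (k (w, u) * sqmod (xi (S (w, u))))%:E).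
Proof.
move=> mxi Bw; apply/integrableP; split.
  apply/measurable_EFinP; apply: measurable_funM => //.
  by apply: (msec _ (measurable_sqmod mxi)).
by under eq_integral do rewrite gee0_abs ?lee_fin ?mulr_ge0 ?sqmod_ge0//.
Qed.

Let integrable_young xi w (t : R) : cmeasurable xi -> (B xi w < +oo)%E ->
  nu.-integrable setT (fun u => (k (w, u) * (sqmod (xi (S (w, u))) + t))%:E).
Proof.
move=> mxi Bw; under eq_fun do rewrite mulrDr EFinD.
apply: integrableD => //; first exact: integrable_B.
under eq_fun do rewrite EFinM.
exact: integrableZr.
Qed.

Let cintegrable_pt xi w : cmeasurable xi -> (B xi w < +oo)%E ->
  cintegrable nu (fun u => K (w, u) * xi (S (w, u))).
Proof.
move=> mxi Bw; apply: cintegrable_le (integrable_young 1 mxi Bw) _ _.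
- apply: (cmeasurable_comp (int_op_integrand_measurable mxi)).
  exact: measurable_pair1.
- move=> u; have := @normRe_le_young R (k (w, u)) 1 (K (w, u)) (xi (S (w, u))) (k_ge0 _) ler01 (dom _).
  by rewrite expr1n; have := normr_ge0 (Re (K (w, u) * xi (S (w, u)))); lra.
- move=> u; have := @normIm_le_young R (k (w, u)) 1 (K (w, u)) (xi (S (w, u))) (k_ge0 _) ler01 (dom _).
  by rewrite expr1n; have := normr_ge0 (Im (K (w, u) * xi (S (w, u)))); lra.
Qed.

(** The integrand is dominated by k (1 + |xi|^2 o S); the row bound controls the first
    term and the column bound, applied to |xi|^2, controls the second for almost
    every w. *)
Lemma ae_cintegrable_int_op xi : is_L2 mu xi ->
  {ae mu, forall w, cintegrable nu (fun u => K (w, u) * xi (S (w, u)))}.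
Proof.
move=> [m1 m2 fin]; have mxi : cmeasurable xi by [].
have iB : mu.-integrable setT (B xi).
  apply/integrableP; split; first exact: mB.
  under eq_integral do rewrite gee0_abs//.
  rewrite (le_lt_trans (B_le mxi))// lte_mul_pinfty// ?lee_fin ?(schur_c2 KSk)//.
have := integrable_ae measurableT iB; apply: filterS => w /(_ I) Bfin.
by apply: cintegrable_pt => //; rewrite ltey_eq Bfin.
Qed.

(** Optimising 2 t a <= b + t^2 c in t gives a^2 <= c b. *)
Let young_opt (a b c : R) : 0 < c -> (forall t : R, 0 <= t -> 2 * t * `|a| <= b + t ^+ 2 * c) ->
  a ^+ 2 <= c * b.
Proof.
move=> c0 /(_ (`|a| / c)) h0.
have {h0} : 2 * (`|a| / c) * `|a| <= b + (`|a| / c) ^+ 2 * c.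
  by apply: h0; apply: divr_ge0 => //; exact: ltW.
have -> : 2 * (`|a| / c) * `|a| = 2 * (a ^+ 2 / c).
  by rewrite -[in RHS](real_normK (num_real a)); field; exact: lt0r_neq0.
have -> : (`|a| / c) ^+ 2 * c = a ^+ 2 / c.
  by rewrite -[in RHS](real_normK (num_real a)); field; exact: lt0r_neq0.
move=> h; have : a ^+ 2 / c <= b by lra.
by rewrite ler_pdivrMr// mulrC.
Qed.

Let sq_pt xi w (G : C -> R) : cmeasurable xi -> (B xi w < +oo)%E ->
  nu.-integrable setT (fun u => (G (K (w, u) * xi (S (w, u))))%:E) ->
  (forall u (t : R), 0 <= t -> 2 * t * `|G (K (w, u) * xi (S (w, u)))| <=
     k (w, u) * (sqmod (xi (S (w, u))) + t ^+ 2)) ->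
  (((\int[nu]_u G (K (w, u) * xi (S (w, u)))) ^+ 2)%:E <= c1%:E * B xi w)%E.
Proof.
move=> mxi Bw iG Gle.
have Bfin : B xi w \is a fin_num by rewrite ge0_fin_numE.
rewrite -(fineK Bfin) -EFinM lee_fin; apply: young_opt => [|t t0]; first exact: schur_c1 KSk.
have iN := integrable_norm iG.
apply: (@le_trans _ _ (\int[nu]_u (2 * t * `|G (K (w, u) * xi (S (w, u)))|))).
  rewrite RintegralZl//; apply: ler_wpM2l; first by rewrite mulr_ge0.
  exact: le_normr_Rintegral.
apply: (@le_trans _ _ (\int[nu]_u (k (w, u) * (sqmod (xi (S (w, u))) + t ^+ 2)))).
  apply: le_Rintegral => //; last by move=> u _; exact: Gle.
    exact: (integrableZl measurableT (2 * t) iN).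
  exact: integrable_young.
under eq_Rintegral do rewrite mulrDr.
rewrite RintegralD//; last 2 first.
- exact: integrable_B.
- exact: (integrableZr measurableT (t ^+ 2) (integrable_k w)).
rewrite RintegralZr; [|by []|exact: integrable_k].
apply: lerD; first exact: lexx.
rewrite mulrC ler_wpM2l ?sqr_ge0//.
rewrite -lee_fin /Rintegral fineK ?(schur_row KSk)//.
exact: integrable_fin_num.
Qed.

(* Re and Im are estimated separately, whence the factor 2. *)
Let sqmod_pt xi w : cmeasurable xi ->
  ((sqmod (int_op K S xi w))%:E <= (2 * c1)%:E * B xi w)%E.
Proof.
move=> mxi; have c1p := schur_c1 KSk.
have [Bw|] := ltP (B xi w) +oo%E; last first.
  by rewrite leye_eq => /eqP ->; rewrite gt0_muley ?leey// lte_fin mulr_gt0.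
have [i1 i2] := cintegrable_pt mxi Bw.
have c10 : (0 <= c1%:E)%E by rewrite lee_fin ltW.
rewrite (_ : (2 * c1)%:E = c1%:E + c1%:E)%E; last by congr EFin; ring.
rewrite (ge0_muleDl _ c10 c10) /sqmod EFinD.
apply: leeD.
  by apply: sq_pt => // u t t0; exact: normRe_le_young.
by apply: sq_pt => // u t t0; exact: normIm_le_young.
Qed.

(** By Cauchy-Schwarz |A xi|^2 <= c int k |xi|^2 o S up to a constant, and the column
    bound integrates the right-hand side. *)
Lemma is_L2_int_op xi : is_L2 mu xi -> is_L2 mu (int_op K S xi).
Proof.
move=> [m1 m2 fin]; have mxi : cmeasurable xi by [].
have [i1 i2] := cmeasurable_int_op mxi; split => //.
apply: (@le_lt_trans _ _ (\int[mu]_w ((2 * c1)%:E * B xi w)))%E.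
  apply: ge0_le_integral => //.
  - by move=> w _; rewrite lee_fin sqmod_ge0.
  - by apply/measurable_EFinP; exact: (measurable_sqmod (conj i1 i2)).
  - by apply: measurable_funeM; exact: mB.
  - by move=> w _; exact: sqmod_pt.
rewrite ge0_integralZl//; last 2 first.
- exact: mB.
- by rewrite lee_fin mulr_ge0// ltW// (schur_c1 KSk).
apply: lte_mul_pinfty => //; first by rewrite lee_fin mulr_ge0// ltW// (schur_c1 KSk).
apply: (le_lt_trans (B_le mxi)); apply: lte_mul_pinfty => //.
by rewrite lee_fin (schur_c2 KSk).
Qed.

(** The column bound on an indicator function: a null set is reached from almost
    every w only along directions that the kernel ignores. *)
Lemma ae_schur_section (P : W -> Prop) : {ae mu, forall w, P w} ->
  {ae mu, forall w, {ae nu, forall u, P (S (w, u)) \/ K (w, u) = 0}}.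
Proof.
move=> [N [mN N0 PN]].
pose H w := (\int[nu]_u ((k (w, u))%:E * (\1_N (S (w, u)))%:E))%E.
have mH : measurable_fun setT H.
  apply: (measurable_fun_fubini_tonelli_F (fun p => (k p)%:E * (\1_N (S p))%:E))%E.
    apply: emeasurable_funM; first exact/measurable_EFinP.
    by apply/measurable_EFinP; apply: (measurableT_comp (measurable_indic mN)).
  by move=> p; rewrite mule_ge0 ?lee_fin.
have H0 w : (0 <= H w)%E.
  by apply: integral_ge0 => u _; rewrite mule_ge0 ?lee_fin.
have : (\int[mu]_w `|H w| = 0)%E.
  under eq_integral do rewrite gee0_abs//.
  apply/eqP; rewrite eq_le integral_ge0//andbT.
  apply: (le_trans (schur_col KSk (h := fun w => (\1_N w)%:E) _ _)).
  - by apply/measurable_EFinP; exact: measurable_indic.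
  - by move=> w; rewrite lee_fin.
  - by rewrite integral_indic// setIT [X in (_ * X)%E]N0 mule0.
move/(ae_eq_integral_abs mu measurableT mH); apply: filterS => w /(_ I) /= Hw.
have mHw : measurable_fun setT (fun u => (k (w, u))%:E * (\1_N (S (w, u)))%:E)%E.
  apply: emeasurable_funM; first exact/measurable_EFinP.
  by apply/measurable_EFinP; apply: msec; exact: measurable_indic.
have : (\int[nu]_u `|(k (w, u))%:E * (\1_N (S (w, u)))%:E| = 0)%E.
  rewrite -[RHS]Hw; apply: eq_integral => u _.
  by rewrite gee0_abs// mule_ge0 ?lee_fin.
move/(ae_eq_integral_abs nu measurableT mHw); apply: filterS => u /(_ I) /= ku.
have [NS|NS] := pselect (N (S (w, u))); last by left; apply: contrapT => /PN.
right; move: ku; rewrite indicE mem_set// mule1 => -[k0].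
have := dom (w, u); rewrite k0 expr0n/= => K0.
have : sqmod (K (w, u)) = 0 by apply/eqP; rewrite eq_le K0 sqmod_ge0.
move/eqP; rewrite /sqmod paddr_eq0 ?sqr_ge0// !sqrf_eq0 => /andP[/eqP r0 /eqP i0].
exact: eq_complexRI.
Qed.

Lemma ae_eq_int_op xi xi' : cmeasurable xi -> cmeasurable xi' ->
  {ae mu, forall w, xi w = xi' w} ->
  {ae mu, forall w, int_op K S xi w = int_op K S xi' w}.
Proof.
move=> m1 m2 /ae_schur_section; apply: filterS => w Hw.
have msec' z : cmeasurable z -> cmeasurable (fun u => K (w, u) * z (S (w, u))).
  move=> mz; apply: (cmeasurable_comp (int_op_integrand_measurable mz)).
  exact: measurable_pair1.
apply: ae_eq_cintegral; [exact: msec'|exact: msec'|].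
by apply: filterS Hw => u [->//|->]; rewrite !mul0r.
Qed.

End schur.

Section schur_composition.
Context {R : realType} {dW d1 d2} {W : measurableType dW}
  {U1 : measurableType d1} {U2 : measurableType d2}.
Variables (mu : {sigma_finite_measure set W -> \bar R})
          (nu1 : {sigma_finite_measure set U1 -> \bar R})
          (nu2 : {sigma_finite_measure set U2 -> \bar R}).
Local Notation C := R[i].

Definition comp_flow (S1 : W * U1 -> W) (S2 : W * U2 -> W) : W * (U1 * U2) -> W :=
  fun p => S2 (S1 (p.1, p.2.1), p.2.2).

(** Used with products of complex kernels and with products of dominating kernels. *)
Definition comp_kernel (T : Type) (op : T -> T -> T) (S1 : W * U1 -> W)
    (K1 : W * U1 -> T) (K2 : W * U2 -> T) : W * (U1 * U2) -> T :=
  fun p => op (K1 (p.1, p.2.1)) (K2 (S1 (p.1, p.2.1), p.2.2)).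

Variables (K1 : W * U1 -> C) (S1 : W * U1 -> W) (k1 : W * U1 -> R) (a1 b1 : R).
Variables (K2 : W * U2 -> C) (S2 : W * U2 -> W) (k2 : W * U2 -> R) (a2 b2 : R).
Hypothesis bd1 : schur_bounded mu nu1 K1 S1 k1 a1 b1.
Hypothesis bd2 : schur_bounded mu nu2 K2 S2 k2 a2 b2.

Let mS1 := schur_mS bd1.
Let mS2 := schur_mS bd2.

Let mproj1 : measurable_fun setT (fun p : W * (U1 * U2) => (p.1, p.2.1)).
Proof. by measurability. Qed.

Let mproj2 : measurable_fun setT (fun p : W * (U1 * U2) => (S1 (p.1, p.2.1), p.2.2)).
Proof. by measurability; apply: (measurableT_comp mS1); measurability. Qed.

Lemma schur_bounded_comp : schur_bounded mu (sfprod nu1 nu2)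
  (comp_kernel *%R S1 K1 K2) (comp_flow S1 S2) (comp_kernel *%R S1 k1 k2)
  (a1 * a2) (b1 * b2).
Proof.
have mk : measurable_fun setT (comp_kernel *%R S1 k1 k2).
  apply: measurable_funM; [exact: measurableT_comp (schur_mk bd1) mproj1|].
  exact: measurableT_comp (schur_mk bd2) mproj2.
have k0 p : 0 <= comp_kernel *%R S1 k1 k2 p.
  by rewrite mulr_ge0 ?(schur_k_ge0 bd1) ?(schur_k_ge0 bd2).
have mks w u1 : measurable_fun setT (fun u2 => k2 (S1 (w, u1), u2)).
  by apply: (measurableT_comp (schur_mk bd2)); measurability.
split => //.
- apply: cmeasurableM; [exact: cmeasurable_comp (schur_mK bd1) mproj1|].
  exact: cmeasurable_comp (schur_mK bd2) mproj2.
- exact: measurableT_comp mS2 mproj2.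
- move=> p; rewrite sqmodM exprMn ler_pM ?sqmod_ge0 ?(schur_dom bd1)//.
  exact: schur_dom bd2 _.
- by rewrite mulr_gt0 ?(schur_c1 bd1) ?(schur_c1 bd2).
- by rewrite mulr_ge0 ?(schur_c2 bd1) ?(schur_c2 bd2).
- move=> w; rewrite fubini_tonelli1//; last 2 first.
  + by apply/measurable_EFinP; apply: (measurableT_comp mk); measurability.
  + by move=> p; rewrite lee_fin.
  rewrite /fubini_F /=.
  apply: (@le_trans _ _ (\int[nu1]_u1 ((k1 (w, u1))%:E * a2%:E)))%E.
    apply: ge0_le_integral => //.
    * by move=> u1 _; apply: integral_ge0 => u2 _; rewrite lee_fin.
    * apply: (measurable_fun_fubini_tonelli_F (fun u => (comp_kernel *%R S1 k1 k2 (w, u))%:E)).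
        by apply/measurable_EFinP; apply: (measurableT_comp mk); measurability.
      by move=> p; rewrite lee_fin.
    * apply/measurable_EFinP; apply: measurable_funM => //.
      by apply: (measurableT_comp (schur_mk bd1)); measurability.
    * move=> u1 _.
      rewrite [leLHS](_ : _ = \int[nu2]_u2 ((k1 (w, u1))%:E * (k2 (S1 (w, u1), u2))%:E))%E//.
      rewrite ge0_integralZl//; last 3 first.
      - exact/measurable_EFinP.
      - by move=> u2 _; rewrite lee_fin (schur_k_ge0 bd2).
      - by rewrite lee_fin (schur_k_ge0 bd1).
      by rewrite lee_wpmul2l ?lee_fin ?(schur_k_ge0 bd1)// (schur_row bd2).
  have a20 := ltW (schur_c1 bd2).
  rewrite ge0_integralZr//; last 2 first.
  + apply/measurable_EFinP.
    by apply: (measurableT_comp (schur_mk bd1)); measurability.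
  + by move=> u1 _; rewrite lee_fin (schur_k_ge0 bd1).
  by rewrite EFinM lee_wpmul2r ?lee_fin ?(schur_row bd1).
- move=> h mh h0.
  pose H w := (\int[nu2]_u2 ((k2 (w, u2))%:E * h (S2 (w, u2))))%E.
  have mint : measurable_fun setT (fun p => (k2 p)%:E * h (S2 p))%E.
    apply: emeasurable_funM; first by apply/measurable_EFinP; exact: schur_mk bd2.
    exact: (measurableT_comp mh).
  have int0 p : (0 <= (k2 p)%:E * h (S2 p))%E.
    by rewrite mule_ge0 ?lee_fin ?(schur_k_ge0 bd2).
  have mH : measurable_fun setT H.
    exact: (measurable_fun_fubini_tonelli_F (fun p => (k2 p)%:E * h (S2 p))%E).
  have H0 w : (0 <= H w)%E by exact: integral_ge0.
  apply: (@le_trans _ _ (b1%:E * \int[mu]_w H w)%E); last first.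
    rewrite EFinM -muleA lee_wpmul2l ?lee_fin ?(schur_c2 bd1)//.
    exact: schur_col bd2 _ mh h0.
  apply: le_trans (schur_col bd1 mH H0).
  rewrite le_eqVlt; apply/orP; left; apply/eqP; apply: eq_integral => w _.
  rewrite fubini_tonelli1//; last 2 first.
  + apply: emeasurable_funM.
      by apply/measurable_EFinP; apply: (measurableT_comp mk); measurability.
    apply: (measurableT_comp mh); apply: (measurableT_comp mS2).
    by measurability; apply: (measurableT_comp mS1); measurability.
  + by move=> p; rewrite mule_ge0 ?lee_fin.
  apply: eq_integral => u1 _; rewrite /H -ge0_integralZl//; last 2 first.
  + by apply: (measurableT_comp mint); measurability.
  + by rewrite lee_fin (schur_k_ge0 bd1).
  by apply: eq_integral => u2 _; rewrite /comp_kernel /= EFinM muleA.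
Qed.

(** The composite kernel is again Schur bounded, so that for almost every w the double
    integral converges absolutely and Fubini applies. *)
Lemma int_op_comp xi : is_L2 mu xi ->
  {ae mu, forall w, int_op nu1 K1 S1 (int_op nu2 K2 S2 xi) w =
    int_op (sfprod nu1 nu2) (comp_kernel *%R S1 K1 K2) (comp_flow S1 S2) xi w}.
Proof.
move=> xi2; have mxi := is_L2_measurable xi2.
have := ae_cintegrable_int_op schur_bounded_comp xi2.
apply: filterS => w iw; rewrite /int_op -cintegral_fubini//.
apply: ae_eq_cintegral.
- have := int_op_integrand_measurable bd1 (cmeasurable_int_op bd2 mxi).
  by move/cmeasurable_comp; apply; exact: measurable_pair1.
- exact: (cmeasurable_cintegral nu2 (cintegrable_measurable iw)).
have := ae_cintegrable1 iw; apply: filterS => u1 iu.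
rewrite -cintegralZ.
  by apply: eq_cintegral => u2; rewrite /comp_kernel /= mulrA.
by congr cintegrable: iu; apply: funext => u2; rewrite /comp_kernel /= mulrA.
Qed.

End schur_composition.

Section schur_criteria.
Context {R : realType}.
Local Notation C := R[i].

Section preserving.
Context {dW dU} {W : measurableType dW} {U : measurableType dU}.
Variables (mu : {sigma_finite_measure set W -> \bar R})
          (nu : {sigma_finite_measure set U -> \bar R}).

(** Exchanging the integrals, the column bound becomes the row bound. *)
Lemma schur_bounded_preserving (K : W * U -> C) (S : W * U -> W) (k : U -> R) (c : R) :
  cmeasurable K -> measurable_fun setT S -> measurable_fun setT k ->
  (forall u, 0 <= k u) -> 0 < c -> (\int[nu]_u (k u)%:E <= c%:E)%E ->
  (forall p, sqmod (K p) <= k p.2 ^+ 2) ->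
  (forall u (h : W -> \bar R), measurable_fun setT h -> (forall w, 0 <= h w)%E ->
    (\int[mu]_w h (S (w, u)) = \int[mu]_w h w)%E) ->
  schur_bounded mu nu K S (fun p => k p.2) c c.
Proof.
move=> mK mS mk k0 c0 kc dom pres.
have mk2 : measurable_fun setT (fun p : W * U => k p.2) by exact: measurableT_comp mk _.
split => //; first exact: ltW.
move=> h mh h0; have mhS : measurable_fun setT (h \o S) by exact: measurableT_comp.
rewrite (fubini_tonelli (fun p => (k p.2)%:E * h (S p))%E); last 2 first.
- by apply: emeasurable_funM => //; exact/measurable_EFinP.
- by move=> p; rewrite mule_ge0 ?lee_fin.
have -> : (\int[nu]_u \int[mu]_w ((k u)%:E * h (S (w, u))) =
    \int[nu]_u ((k u)%:E * \int[mu]_w h w))%E.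
  apply: eq_integral => u _; rewrite ge0_integralZl ?pres//.
    by apply: (measurableT_comp mhS); exact: measurable_pair2.
  by rewrite lee_fin.
rewrite ge0_integralZr//; last 3 first.
- exact/measurable_EFinP.
- by move=> u _; rewrite lee_fin.
- exact: integral_ge0.
by rewrite lee_wpmul2r// integral_ge0.
Qed.

End preserving.

Section coordinate.
Context {dA dT dB} {A : measurableType dA} {T : measurableType dT} {B : measurableType dB}.
Variables (mA : {sigma_finite_measure set A -> \bar R})
  (mT : {sigma_finite_measure set T -> \bar R}) (mB : {sigma_finite_measure set B -> \bar R}).

(** The classical Schur test in one coordinate, the others being spectators. *)
Lemma schur_bounded_coordinate (K : (A * T) * B * T -> C) (k : T * T -> R) (c : R) :
  cmeasurable K -> measurable_fun setT k -> (forall p, 0 <= k p) -> 0 < c ->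
  (forall r, \int[mT]_t (k (r, t))%:E <= c%:E)%E ->
  (forall t, \int[mT]_r (k (r, t))%:E <= c%:E)%E ->
  (forall p, sqmod (K p) <= k (p.1.1.2, p.2) ^+ 2) ->
  schur_bounded (sfprod (sfprod mA mT) mB) mT K
    (fun p => ((p.1.1.1, p.2), p.1.2)) (fun p => k (p.1.1.2, p.2)) c c.
Proof.
move=> mK mk k0 c0 row col dom.
have mS : measurable_fun setT (fun p : (A * T) * B * T => ((p.1.1.1, p.2), p.1.2)).
  by measurability.
have mk4 : measurable_fun setT (fun p : (A * T) * B * T => k (p.1.1.2, p.2)).
  by apply: (measurableT_comp mk); measurability.
split => //; [exact: ltW|by move=> w; exact: row|].
move=> h mh h0.
have mhS : measurable_fun setT (fun p : (A * T) * B * T => h ((p.1.1.1, p.2), p.1.2)).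
  exact: (measurableT_comp mh).
rewrite (fubini_tonelli (fun p => (k (p.1.1.2, p.2))%:E * h ((p.1.1.1, p.2), p.1.2))%E); last 2 first.
- by apply: emeasurable_funM => //; exact/measurable_EFinP.
- by move=> p; rewrite mule_ge0 ?lee_fin.
pose H a := (\int[mB]_b h (a, b))%E.
have mH : measurable_fun setT H by exact: (measurable_fun_fubini_tonelli_F h).
have H0 a : (0 <= H a)%E by exact: integral_ge0.
have -> : (\int[sfprod (sfprod mA mT) mB]_w h w = \int[mT]_t \int[mA]_a H (a, t))%E.
  by rewrite fubini_tonelli1// fubini_tonelli2.
rewrite -ge0_integralZl//; last 3 first.
- exact: (measurable_fun_fubini_tonelli_G H).
- by move=> t _; exact: integral_ge0.
- by rewrite lee_fin ltW.
have mkh t : measurable_fun setT (fun w : (A * T) * B => (k (w.1.2, t))%:E * h ((w.1.1, t), w.2))%E.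
  apply: emeasurable_funM.
    by apply/measurable_EFinP; apply: (measurableT_comp mk); measurability.
  by apply: (measurableT_comp mh); measurability.
apply: ge0_le_integral => //.
- by move=> t _; apply: integral_ge0 => w _; rewrite mule_ge0 ?lee_fin.
- apply: (measurable_fun_fubini_tonelli_G (fun p : (A * T) * B * T =>
    (k (p.1.1.2, p.2))%:E * h ((p.1.1.1, p.2), p.1.2))%E).
    by apply: emeasurable_funM => //; exact/measurable_EFinP.
  by move=> p; rewrite mule_ge0 ?lee_fin.
- apply: measurable_funeM; exact: (measurable_fun_fubini_tonelli_G H).
move=> t _; rewrite fubini_tonelli1; last 2 first.
- exact: mkh t.
- by move=> p; rewrite mule_ge0 ?lee_fin.
have mks : measurable_fun setT (fun r => (k (r, t))%:E).
  by apply/measurable_EFinP; apply: (measurableT_comp mk); measurability.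
have mHt : measurable_fun setT (fun a => H (a, t)).
  by apply: (measurableT_comp mH); measurability.
have mHt2 : measurable_fun setT (fun x : A * T => H (x.1, t)).
  by apply: (measurableT_comp mH); measurability.
have -> : (\int[sfprod mA mT]_x fubini_F mB (fun w : (A * T) * B =>
      (k (w.1.2, t))%:E * h ((w.1.1, t), w.2)) x =
    \int[sfprod mA mT]_x ((k (x.2, t))%:E * H (x.1, t)))%E.
  apply: eq_integral => x _; rewrite /fubini_F /= ge0_integralZl ?lee_fin//.
  by apply: (measurableT_comp mh); measurability.
rewrite fubini_tonelli1; last 2 first.
- by apply: emeasurable_funM => //; apply/measurable_EFinP; apply: (measurableT_comp mk); measurability.
- by move=> p; rewrite mule_ge0 ?lee_fin.
rewrite /fubini_F /= -ge0_integralZl//; last by rewrite lee_fin ltW.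
apply: ge0_le_integral => //.
- by move=> a _; apply: integral_ge0 => r _; rewrite mule_ge0 ?lee_fin.
- apply: (measurable_fun_fubini_tonelli_F (fun x : A * T => (k (x.2, t))%:E * H (x.1, t)))%E.
    by apply: emeasurable_funM => //; apply/measurable_EFinP; apply: (measurableT_comp mk); measurability.
  by move=> p; rewrite mule_ge0 ?lee_fin.
- exact: measurable_funeM.
move=> a _; rewrite ge0_integralZr//; first by rewrite lee_wpmul2r.
by move=> r _; rewrite lee_fin.
Qed.

End coordinate.

End schur_criteria.

(** * Adjoints on square-integrable functions and the unitary Z *)

Section adjoint_L2.
Context {R : realType} {d} {T : measurableType d}.
Variable mu : {measure set T -> \bar R}.
Local Notation C := R[i].
Local Notation Re := complex.Re.
Local Notation Im := complex.Im.

Lemma is_L2P (f : T -> C) : is_L2 mu f <->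
  cmeasurable f /\ mu.-integrable setT (fun x => (sqmod (f x))%:E).
Proof.
split=> [[f1 f2 foo]|[mf /integrableP[_ foo]]].
  split=> //; apply/integrableP; split.
    by apply/measurable_EFinP; exact: measurable_sqmod.
  by under eq_integral do rewrite gee0_abs ?lee_fin ?sqmod_ge0//.
case: (mf) => f1 f2; split=> //; apply: le_lt_trans foo.
by under [leRHS]eq_integral do rewrite gee0_abs ?lee_fin ?sqmod_ge0//.
Qed.

Lemma cintegrable_L2M (f g : T -> C) : is_L2 mu f -> is_L2 mu g ->
  cintegrable mu (fun x => f x * conjc (g x)).
Proof.
move=> /is_L2P[mf fi] /is_L2P[mg gi].
have sc (a : C) : sqmod (conjc a) = sqmod a by case: a => u v; rewrite /sqmod/= sqrrN.
have bd (a b : C) : sqmod (a * conjc b) <= (sqmod a + sqmod b) ^+ 2.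
  rewrite sqmodM sc; have := sqmod_ge0 a; have := sqmod_ge0 b.
  by move=> b0 a0; rewrite sqrrD; nra.
apply: (@cintegrable_le _ _ _ _ _ (fun x => sqmod (f x) + sqmod (g x))).
- by apply: cmeasurableM => //; exact: cmeasurable_conj.
- by under eq_fun do rewrite EFinD; exact: integrableD.
- move=> x; rewrite -ler_sqr ?nnegrE ?(addr_ge0 (sqmod_ge0 _) (sqmod_ge0 _))//.
  by rewrite real_normK ?num_real// (le_trans (sqrRe_le _)).
- move=> x; rewrite -ler_sqr ?nnegrE ?(addr_ge0 (sqmod_ge0 _) (sqmod_ge0 _))//.
  by rewrite real_normK ?num_real// (le_trans (sqrIm_le _)).
Qed.

Lemma is_L2_ae (g h : T -> C) : cmeasurable g -> is_L2 mu h ->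
  {ae mu, forall w, g w = h w} -> is_L2 mu g.
Proof.
move=> mg /is_L2P[mh ih] gh; apply/is_L2P; split => //.
apply/integrableP; split; first by apply/measurable_EFinP; exact: measurable_sqmod.
have /integrableP[_] := ih; apply: le_lt_trans.
rewrite le_eqVlt; apply/orP; left; apply/eqP; apply: ae_eq_integral => //.
- by apply: measurableT_comp => //; apply/measurable_EFinP; exact: measurable_sqmod.
- by apply: measurableT_comp => //; apply/measurable_EFinP; exact: measurable_sqmod.
- by apply: filterS gh => w -> _.
Qed.

Lemma is_L2B (f g : T -> C) : is_L2 mu f -> is_L2 mu g ->
  is_L2 mu (fun x => f x - g x).
Proof.
move=> /is_L2P[mf fi] /is_L2P[mg gi]; apply/is_L2P; split.
  exact: cmeasurableB.
have i2 : mu.-integrable setT (fun x => (2 * (sqmod (f x) + sqmod (g x)))%:E).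
  exact: (integrableZl measurableT 2 (integrableD measurableT fi gi)).
apply: (le_integrable _ _ _ i2) => //.
  by apply/measurable_EFinP; apply: measurable_sqmod; exact: cmeasurableB.
move=> x _; rewrite /= lee_fin ger0_norm ?sqmod_ge0//.
apply: le_trans (ler_norm _); rewrite /sqmod !ReDc !ImDc !ReNc !ImNc.
have := sqr_ge0 (Re (f x) + Re (g x)); have := sqr_ge0 (Im (f x) + Im (g x)).
by rewrite !expr2; lra.
Qed.

(** The defining property of the adjoint determines it almost everywhere: it may be
    tested on the difference of two candidates. *)
Lemma adjoint_ae_eq (A : (T -> C) -> T -> C) (g h0 : T -> C) :
  is_L2 mu h0 -> (forall f, is_L2 mu f -> inner mu (A f) g = inner mu f h0) ->
  is_L2 mu (adjoint mu A g) /\ {ae mu, forall x, adjoint mu A g x = h0 x}.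
Proof.
move=> h02 h0P.
have [h2 hP] : is_L2 mu (adjoint mu A g) /\ (forall f, is_L2 mu f ->
    inner mu (A f) g = inner mu f (adjoint mu A g)).
  by rewrite /adjoint; case: xgetP => [h -> []//|/(_ h0)]; case.
split=> //; set h := adjoint mu A g in h2 hP *.
have d2 := is_L2B h2 h02; have /is_L2P[mD iD] := d2.
have eqi := etrans (esym (hP _ d2)) (h0P _ d2).
have : cintegral mu (fun x => (h x - h0 x) * conjc (h x - h0 x)) = 0.
  rewrite -(subrr (inner mu (fun x => h x - h0 x) h0)) -{1}eqi.
  rewrite /inner -cintegralB//; [|exact: cintegrable_L2M..].
  by apply: eq_cintegral => x; rewrite rmorphB mulrBr.
move/(congr1 (fun z => Re z)) => /=; under eq_Rintegral.
  move=> x _; rewrite (_ : Re _ = sqmod (h x - h0 x)); last first.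
    by case: (_ - _) => u v; rewrite /sqmod/=; ring.
  over.
move=> i0.
have : (\int[mu]_x `|(sqmod (h x - h0 x))%:E| = 0)%E.
  under eq_integral do rewrite gee0_abs ?lee_fin ?sqmod_ge0//.
  by rewrite -(fineK (integrable_fin_num measurableT iD)); congr EFin.
have mS : measurable_fun setT (fun x => (sqmod (h x - h0 x))%:E).
  exact: measurable_int iD.
move/(ae_eq_integral_abs mu measurableT mS); apply: filterS => x /(_ I) [].
move/eqP; rewrite /sqmod paddr_eq0 ?sqr_ge0// !sqrf_eq0 !ReDc !ImDc !ReNc !ImNc.
by rewrite !subr_eq0 => /andP[/eqP r0 /eqP i0']; exact: eq_complexRI.
Qed.

End adjoint_L2.

Section dilations.
Context {R : realType} (lam : R) (U : lmodType R).
Local Notation E r := (expR (lam * r)).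
Implicit Types (c r s : R) (z u v q : U).

Lemma expR_lamD r s : E (r + s) = E r * E s.
Proof. by rewrite mulrDr expRD. Qed.

Lemma expR_lamNK r : E (- r) * E r = 1.
Proof. by rewrite -expR_lamD addNr mulr0 expR0. Qed.

Lemma scaler_lamK r q : E (- r) *: (E r *: q) = q.
Proof. by rewrite scalerA expR_lamNK scale1r. Qed.

Lemma scaler_lamVK r q : E r *: (E (- r) *: q) = q.
Proof. by rewrite scalerA mulrC expR_lamNK scale1r. Qed.

Lemma scaler_lamD r s q : E (r + s) *: q = E r *: (E s *: q).
Proof. by rewrite expR_lamD scalerA. Qed.

Lemma scaler_lamDK r s q : E (- r) *: (E (r + s) *: q) = E s *: q.
Proof. by rewrite (scaler_lamD r s) (scaler_lamK r). Qed.

Lemma scaler_telescope c z u v : z + c *: u + c *: (v - u) = z + c *: v.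
Proof. by rewrite scalerBr -addrA [c *: u + _]addrC subrK. Qed.
End dilations.

Section Z_operator.
Context {R : realType} (n : nat) (lam : R).
Local Notation C := R[i].
Local Notation W := (pt R n * pt R n)%type.
Local Notation mu := (@lebesgue_pt2 R n).
Local Notation E r := (expR (lam * r)).
Local Notation Re := complex.Re.
Local Notation Im := complex.Im.

(** With these notations Z xi = jacZ e(angleZ) (xi o flowZ), and the Jacobian
    determinant of flowZ is the square of jacZ. *)
Definition flowZ (w : W) : W :=
  ((w.1.1 + (1 - E w.2.2) *: w.2.1, w.1.2), (E w.1.2 *: w.2.1, w.2.2)).

Definition flowZV (w : W) : W :=
  ((w.1.1 + ((E w.2.2 - 1) * E (- w.1.2)) *: w.2.1, w.1.2),
   (E (- w.1.2) *: w.2.1, w.2.2)).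

Definition angleZ (w : W) : R :=
  Defs.eta lam w.1.2 * beta (w.1.1.1 - E w.2.2 *: w.2.1.1) w.2.1.2
  - Defs.eta lam w.1.2 * beta (E w.2.2 *: w.2.1.1) (w.1.1.2 - E w.2.2 *: w.2.1.2).

Definition jacZ (w : W) : R := E w.1.2 ^+ n.

Definition Zinv (xi : W -> C) : W -> C := fun w =>
  (jacZ (flowZV w))^-1%:C%C * e (- angleZ (flowZV w)) * xi (flowZV w).

Lemma jacZ_gt0 w : 0 < jacZ w.
Proof. by rewrite exprn_gt0// expR_gt0. Qed.

Lemma flowZK : cancel flowZ flowZV.
Proof.
move=> [[z r] [z' r']]; rewrite /flowZ /flowZV/=.
congr ((_, _), (_, _)); last by rewrite scalerA expR_lamNK scale1r.
rewrite scalerA -mulrA expR_lamNK mulr1 -addrA -scalerDl.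
by rewrite (_ : 1 - _ + _ = 0) ?scale0r ?addr0//; ring.
Qed.

Lemma ZopE (xi : W -> C) w :
  Zop lam xi w = (jacZ w)%:C%C * e (angleZ w) * xi (flowZ w).
Proof.
case: w => [[[x y] r] [[x' y'] r']]; rewrite /Zop /jacZ /angleZ /flowZ /ebar/=.
rewrite -(mulrA _%:C%C) -eD; congr (_ * e _ * xi _); first by rewrite addrC.
rewrite scalerBl scale1r /=; congr ((_, _, _), _); rewrite /= addrC addrA.
  by rewrite addrAC [_ + x]addrC.
by rewrite addrAC [_ + y]addrC.
Qed.

Lemma measurable_flowZ : measurable_fun setT flowZ.
Proof. by rewrite /flowZ; measurability. Qed.

Lemma measurable_flowZV : measurable_fun setT flowZV.
Proof. by rewrite /flowZV; measurability. Qed.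

Lemma measurable_angleZ : measurable_fun setT angleZ.
Proof. by rewrite /angleZ; measurability. Qed.

Lemma measurable_jacZ : measurable_fun setT jacZ.
Proof. by rewrite /jacZ; measurability. Qed.

Lemma ge0_integral_flowZ (G : W -> \bar R) : measurable_fun setT G ->
  (forall w, 0 <= G w)%E ->
  (\int[mu]_w ((jacZ w ^+ 2)%:E * G (flowZ w)) = \int[mu]_w G w)%E.
Proof.
move=> mG G0.
rewrite -[RHS](@lebesgue_pt2_shear _ n (fun p => (1 - E p.2.2) *: p.2.1)
  (fun p => E p.1) (fun=> 0))//; last first.
- by move=> r; exact: expR_gt0.
- by measurability.
- by measurability.
by apply: eq_integral => w _; rewrite addr0.
Qed.

Lemma Rintegral_flowZ (G : W -> R) : measurable_fun setT G ->
  \int[mu]_w (jacZ w ^+ 2 * G (flowZ w)) = \int[mu]_w G w.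
Proof.
move=> mG; have mGE : measurable_fun setT (EFin \o G) by exact/measurable_EFinP.
rewrite /Rintegral; congr fine; rewrite integralE [in RHS]integralE.
rewrite -(ge0_integral_flowZ (measurable_funepos mGE) (funepos_ge0 _)).
rewrite -(ge0_integral_flowZ (measurable_funeneg mGE) (funeneg_ge0 _)).
congr (_ - _)%E; apply: eq_integral => w _.
  rewrite !funeposE /= -!EFin_max -EFinM -[in LHS](mulr0 (jacZ w ^+ 2)).
  by rewrite maxr_pMr// sqr_ge0.
rewrite !funenegE /= -!EFin_max -EFinM -mulrN -[in LHS](mulr0 (jacZ w ^+ 2)).
by rewrite maxr_pMr// sqr_ge0.
Qed.

Lemma cintegral_flowZ (G : W -> C) : cmeasurable G ->
  cintegral mu (fun w => (jacZ w ^+ 2)%:C%C * G (flowZ w)) = cintegral mu G.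
Proof.
move=> [G1 G2]; apply: eq_complexRI => /=.
  rewrite -(Rintegral_flowZ G1); apply: eq_Rintegral => w _.
  by rewrite ReMc/= mul0r subr0.
rewrite -(Rintegral_flowZ G2); apply: eq_Rintegral => w _.
by rewrite ImMc/= mul0r addr0.
Qed.

(** As the Jacobian of flowZ does not vanish, preimages of null sets are null. *)
Lemma ae_flowZ (P : W -> Prop) : {ae mu, forall w, P w} ->
  {ae mu, forall w, P (flowZ w)}.
Proof.
move=> [N [mN N0 PN]].
exists (flowZ @^-1` N); split.
- by rewrite -[X in measurable X]setTI; exact: measurable_flowZ.
- have m1 : measurable_fun setT (fun w => ((jacZ w) ^+ 2)%:E * (\1_N (flowZ w))%:E)%E.
    apply: emeasurable_funM; apply/measurable_EFinP.
      by apply: measurable_funX; exact: measurable_jacZ.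
    by apply: (measurableT_comp (measurable_indic mN)); exact: measurable_flowZ.
  have : (\int[mu]_w `|((jacZ w) ^+ 2)%:E * (\1_N (flowZ w))%:E| = 0)%E.
    under eq_integral do rewrite gee0_abs ?mule_ge0 ?lee_fin ?sqr_ge0//.
    transitivity (\int[mu]_w (\1_N w)%:E)%E; last first.
      by rewrite integral_indic; [rewrite setIT; exact: N0|by []|by []].
    apply: (ge0_integral_flowZ (G := fun w => (\1_N w)%:E)).
      by apply/measurable_EFinP; exact: measurable_indic.
    by move=> w; rewrite lee_fin.
  move/(ae_eq_integral_abs mu measurableT m1) => [M [mM M0 HM]].
  apply: (subset_measure0 _ mM _ M0).
    by rewrite -[X in measurable X]setTI; exact: measurable_flowZ.
  move=> w /= Nw; apply: HM => /= /(_ I) /eqP.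
  rewrite indicE mem_set// mule1 eqe sqrf_eq0.
  by rewrite gt_eqF// jacZ_gt0.
- by move=> w /= nP; apply: PN.
Qed.

Lemma sqmod_Zinv xi w : sqmod (Zinv xi w) =
  (jacZ (flowZV w) ^+ 2)^-1 * sqmod (xi (flowZV w)).
Proof.
rewrite /Zinv !sqmodM sqmod_e mulr1; congr (_ * _).
by rewrite /sqmod/= expr0n/= addr0 exprVn.
Qed.

Lemma is_L2_Zinv xi : is_L2 mu xi -> is_L2 mu (Zinv xi).
Proof.
move=> /is_L2P[mxi ixi].
have mZ : cmeasurable (Zinv xi).
  apply: cmeasurableM; last exact: cmeasurable_comp measurable_flowZV.
  apply: cmeasurableM.
    apply: cmeasurable_real.
    rewrite (_ : (fun w => _) = fun w => E (- w.1.2) ^+ n); first by measurability.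
    by apply: funext => w; rewrite /jacZ /= -exprVn -expRN mulrN.
  apply: (cmeasurable_comp (@cmeasurable_e R)).
  apply: measurable_funN; apply: (measurableT_comp measurable_angleZ).
  exact: measurable_flowZV.
have [m1 m2] := mZ; split => //.
rewrite -(ge0_integral_flowZ (G := fun w => (sqmod (Zinv xi w))%:E)); last 2 first.
- by apply/measurable_EFinP; exact: measurable_sqmod.
- by move=> w; rewrite lee_fin sqmod_ge0.
have /integrableP[_] := ixi; apply: le_lt_trans.
apply: ge0_le_integral => //.
- by move=> w _; rewrite mule_ge0 ?lee_fin ?sqr_ge0 ?sqmod_ge0.
- apply: emeasurable_funM; apply/measurable_EFinP.
    by apply: measurable_funX; exact: measurable_jacZ.
  by apply: (measurableT_comp (measurable_sqmod mZ)); exact: measurable_flowZ.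
- by apply: measurableT_comp => //; apply/measurable_EFinP; exact: measurable_sqmod.
- move=> w _; rewrite sqmod_Zinv flowZK -EFinM mulrA divff ?mul1r.
    by rewrite gee0_abs// lee_fin sqmod_ge0.
  by rewrite sqrf_eq0 gt_eqF// jacZ_gt0.
Qed.

Let conjcM (a b : C) : conjc (a * b) = conjc a * conjc b.
Proof. by case: a b => ? ? [? ?]; apply: eq_complexRI => /=; ring. Qed.

Lemma inner_Zop (f xi : W -> C) : cmeasurable f -> cmeasurable (Zinv xi) ->
  inner mu (Zop lam f) xi = inner mu f (Zinv xi).
Proof.
move=> mf mxi; rewrite /inner -(cintegral_flowZ (G := fun w => f w * conjc (Zinv xi w))).
  apply: eq_cintegral => w; rewrite ZopE /Zinv flowZK !conjcM conj_e opprK.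
  have jn0 : jacZ w != 0 by rewrite gt_eqF ?jacZ_gt0.
  have -> : conjc ((jacZ w)^-1%:C%C) = (jacZ w)^-1%:C%C :> C by rewrite /= oppr0.
  rewrite -[in LHS](mulfVK jn0 (jacZ w)) expr2.
  by rewrite !rmorphM/=; ring.
by apply: cmeasurableM => //; exact: cmeasurable_conj.
Qed.

Lemma adjoint_Zop xi : is_L2 mu xi -> is_L2 mu (adjoint mu (Zop lam) xi) /\
  {ae mu, forall w, adjoint mu (Zop lam) xi w = Zinv xi w}.
Proof.
move=> xi2; apply: adjoint_ae_eq; first exact: is_L2_Zinv.
move=> f f2; apply: inner_Zop; first by case/is_L2P: f2.
by case/is_L2P: (is_L2_Zinv xi2).
Qed.

End Z_operator.

(** * Schwartz functions *)

Section continuous_measurable.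
Context {R : realType} (n : nat).
Local Notation lattice := ('rV[int]_n * 'rV[int]_n * int)%type.

Lemma norm_rV_coord (v : 'rV[R]_n) i : `|v ord0 i| <= `|v|.
Proof.
rewrite [leRHS]/Num.Def.normr /= mx_normrE.
exact: (le_bigmax _ (fun i : 'I_1 * 'I_n => `|v i.1 i.2|) (ord0, i)).
Qed.

Lemma norm_rV_le (v : 'rV[R]_n) (c : R) : 0 <= c -> (forall i, `|v ord0 i| <= c) ->
  `|v| <= c.
Proof.
move=> c0 h; rewrite [leLHS]/Num.Def.normr /= mx_normrE; apply/bigmax_leP; split=> // -[i j] _.
by rewrite /= (ord1 i).
Qed.

Let floorM k (t : R) : int := Num.floor (t * k.+1%:R).
Let enc k (z : pt R n) : lattice :=
  (map_mx (floorM k) z.1.1, map_mx (floorM k) z.1.2, floorM k z.2).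
Let unscale k (m : int) : R := m%:~R / k.+1%:R.
Let dec k (d : lattice) : pt R n :=
  (map_mx (unscale k) d.1.1, map_mx (unscale k) d.1.2, unscale k d.2).

Let unscaleK k t : `|t - unscale k (floorM k t)| <= k.+1%:R^-1.
Proof.
have k0 : 0 < k.+1%:R :> R by rewrite ltr0n.
rewrite -(@ler_pM2r _ k.+1%:R)// mulVf ?gt_eqF//.
rewrite -(ger0_norm (ltW k0)) -normrM mulrBl /unscale mulfVK ?gt_eqF//.
have /andP[h1 h2] := floor_itv (t * k.+1%:R).
rewrite ger0_norm ?subr_ge0//; move: h2; rewrite rmorphD/= /floorM.
by rewrite lerBlDl => /ltW.
Qed.

Let encK k z : `|z - dec k (enc k z)| <= k.+1%:R^-1.
Proof.
have h0 : 0 <= k.+1%:R^-1 :> R by rewrite invr_ge0 ler0n.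
rewrite !prod_normE /= !ge_max unscaleK andbT; apply/andP; split;
  by apply: norm_rV_le => // i; rewrite !mxE unscaleK.
Qed.

Let cvg_enc z : dec k (enc k z) @[k --> \oo] --> z.
Proof.
apply/cvgrPdist_lt => eps e0.
have := near_infty_natSinv_lt (PosNum e0); apply: filterS => k /=.
exact: le_lt_trans.
Qed.

Let measurable_floor k m (g : pt R n -> R) : measurable_fun setT g ->
  measurable [set z | floorM k (g z) = m].
Proof.
move=> mg.
have -> : [set z | floorM k (g z) = m] =
    setT `&` (fun z => g z * k.+1%:R) @^-1` `[m%:~R, (m + 1)%:~R[%classic.
  rewrite setTI; apply/seteqP; split=> z /=; rewrite in_itv/= -floor_eq => /eqP//.
by apply: measurable_funM.
Qed.

Let measurable_enc k d : measurable [set z | enc k z = d].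
Proof.
have mc (g : pt R n -> 'rV[R]_n) (v : 'rV[int]_n) : measurable_fun setT g ->
    measurable [set z | map_mx (floorM k) (g z) = v].
  move=> mg; have -> : [set z | map_mx (floorM k) (g z) = v] =
      \bigcap_(i in [set: 'I_n]) [set z | floorM k (g z ord0 i) = v ord0 i].
    apply/seteqP; split=> z /=; first by move=> <- i _ /=; rewrite mxE.
    by move=> h; apply/rowP => i; rewrite mxE; exact: h.
  apply: fin_bigcap_measurable => // i _; apply: measurable_floor.
  by apply: (measurableT_comp (measurable_coord i)).
have -> : [set z | enc k z = d] = [set z | map_mx (floorM k) z.1.1 = d.1.1] `&`
   [set z | map_mx (floorM k) z.1.2 = d.1.2] `&` [set z | floorM k z.2 = d.2].
  apply/seteqP; split=> z /=; first by move=> <-.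
  by case: d => [[d1 d2] d3] /= [[<- <-] <-].
by apply: measurableI; [apply: measurableI; apply: mc|apply: measurable_floor];
  measurability.
Qed.

(** The product sigma-algebra is compared with the topology through rounding:
    a continuous function is the pointwise limit of its values at lattice points. *)
Lemma continuous_measurable_pt (f : pt R n -> R) : continuous f ->
  measurable_fun setT f.
Proof.
move=> cf; apply: (@measurable_fun_cvg _ _ _ _ (fun k z => f (dec k (enc k z)))).
  move=> k _ Y mY; rewrite setTI.
  have -> : (fun z => f (dec k (enc k z))) @^-1` Y =
      \bigcup_(d : lattice) ([set z | enc k z = d] `&` [set z | Y (f (dec k d))]).
    apply/seteqP; split=> z /=; first by move=> Yz; exists (enc k z).
    by case=> d _ /= [<-].
  apply: countable_bigcupT_measurable => [|d]; first exact: countableP.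
  have [Yd|Yd] := pselect (Y (f (dec k d))).
    rewrite (_ : [set z | Y _] = setT) ?setIT//.
    by apply/seteqP; split.
  rewrite (_ : [set z | Y _] = set0) ?setI0//.
  by apply/seteqP; split.
by move=> z _; apply: continuous_cvg; [exact: cf|exact: cvg_enc].
Qed.

End continuous_measurable.

Section schwartz_bounds.
Context {R : realType}.

Lemma integral_lebesgueRE (G : R -> \bar R) : measurable_fun setT G ->
  (forall x, 0 <= G x)%E ->
  (\int[lebesgueR]_x G x = \int[@lebesgue_measure R]_x G x)%E.
Proof.
move=> mG G0.
have mid : measurable_fun [set: measurableTypeR R] (fun x => x : R).
  by move=> _ Y mY; rewrite setTI.
have := @ge0_integral_pushforward _ _ (measurableTypeR R) R R _ mid (@lebesgue_measure R) setT G.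
by move=> <-//.
Qed.

Let g (t : R) : R := (1 + t ^+ 2)^-1.

Let g_gt0 t : 0 < g t.
Proof. by rewrite invr_gt0 ltr_pwDl// sqr_ge0. Qed.

Let measurable_g : measurable_fun setT g.
Proof. by apply: continuous_measurable_fun; exact: continuous_oneDsqrV. Qed.

(* By symmetry and the primitive atan on the half-line. *)
Let integral_g_lty : (\int[@lebesgueR R]_t (g t)%:E < +oo)%E.
Proof.
have g0 t : (0 <= (g t)%:E)%E by rewrite lee_fin ltW.
rewrite integral_lebesgueRE//; last exact/measurable_EFinP.
rewrite ge0_symfun_integralT; last 3 first.
- by move=> t; exact: ltW.
- exact: continuous_oneDsqrV.
- by move=> t; rewrite /g/= sqrrN.
rewrite (_ : [set x | _] = `[0, +oo[%classic); last first.
  by apply/seteqP; split => x/=; rewrite in_itv/= andbT.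
rewrite (@ge0_continuous_FTC2y _ _ atan _ (pi / 2))//.
- by rewrite atan0 -EFinB -EFinM ltry.
- by move=> t _; exact: ltW.
- by apply: continuous_in_subspaceT => x ?; exact: continuous_oneDsqrV.
- exact: cvgy_atan.
- by apply: cvg_at_right_filter; exact: continuous_atan.
- by move=> x _; rewrite derive1_atan.
Qed.

(** An integrable weight on R^n of product form, so that its integral factors. *)
Definition decay n (v : 'rV[R]_n) : R := \prod_(i < n) (1 + v ord0 i ^+ 2)^-1.

Lemma decay_gt0 n (v : 'rV[R]_n) : 0 < decay v.
Proof. by apply: prodr_gt0 => i _; exact: g_gt0. Qed.

Lemma measurable_decay n : measurable_fun setT (@decay n).
Proof.
apply: measurable_prod => i _; apply: (measurableT_comp measurable_g).
exact: measurable_coord.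
Qed.

Lemma decay_consrV n t (v : 'rV[R]_n) : decay (consrV (t, v)) = g t * decay v.
Proof.
rewrite /decay big_ord_recl; congr (_ * _).
  by rewrite /g /consrV mxE /=; case: fintype.splitP => // j _; rewrite mxE.
apply: eq_bigr => i _; congr (_ + _ ^+ 2)^-1.
rewrite /consrV mxE; case: fintype.splitP => [j /= ji|j /= ji].
  by have := ltn_ord j; rewrite -ji.
by congr (v _ _); apply: val_inj; case: ji.
Qed.

Lemma integral_decay_lty n : (\int[@lebesgue_rV R n]_v (decay v)%:E < +oo)%E.
Proof.
have d0 m (v : 'rV[R]_m) : (0 <= (decay v)%:E)%E by rewrite lee_fin ltW ?decay_gt0.
have md m : measurable_fun setT (fun v : 'rV[R]_m => (decay v)%:E).
  by apply/measurable_EFinP; exact: measurable_decay.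
elim: n => [|n IH].
  rewrite [X in (X < _)%E](_ : _ = \int[\d_(0%R : 'rV[R]_0)]_v (decay v)%:E)%E//.
  rewrite integral_dirac; [|by []|exact: md].
  by rewrite [X in (X * _)%E](_ : _ = 1%E) ?mul1e ?ltry//; exact: diracT.
rewrite ge0_integral_lebesgue_rVS//.
rewrite (eq_integral (fun t => (g t)%:E * \int[lebesgue_rV n]_v (decay v)%:E))%E; last first.
  move=> t _; under eq_integral => v _ do rewrite decay_consrV EFinM.
  by rewrite ge0_integralZl ?lee_fin ?ltW ?g_gt0//; exact: md.
rewrite ge0_integralZr//; last 3 first.
- exact/measurable_EFinP.
- by move=> t _; rewrite lee_fin ltW.
- exact: integral_ge0.
have I0 : (0 <= \int[@lebesgueR R]_t (g t)%:E)%E.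
  by apply: integral_ge0 => t _; rewrite lee_fin ltW.
by apply: lte_mul_pinfty => //; rewrite ge0_fin_numE.
Qed.

Definition decayQ n (q : Q R n) : R := decay q.1 * decay q.2.

Lemma decayQ_ge0 n (q : Q R n) : 0 <= decayQ q.
Proof. by rewrite mulr_ge0 ?ltW ?decay_gt0. Qed.

Lemma measurable_decayQ n : measurable_fun setT (@decayQ n).
Proof.
by apply: measurable_funM; apply: (measurableT_comp (@measurable_decay n)).
Qed.

Lemma integral_decayQ_lty n :
  (\int[sfprod (@lebesgue_rV R n) (@lebesgue_rV R n)]_q (decayQ q)%:E < +oo)%E.
Proof.
have d0 (v : 'rV[R]_n) : (0 <= (decay v)%:E)%E by rewrite lee_fin ltW ?decay_gt0.
have md : measurable_fun setT (fun v : 'rV[R]_n => (decay v)%:E).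
  by apply/measurable_EFinP; exact: measurable_decay.
rewrite fubini_tonelli1; last 2 first.
- by apply/measurable_EFinP; exact: measurable_decayQ.
- by move=> q; rewrite lee_fin decayQ_ge0.
rewrite /fubini_F.
rewrite (eq_integral (fun x => (decay x)%:E * \int[lebesgue_rV n]_y (decay y)%:E))%E; last first.
  move=> x _; under eq_integral => y _ do rewrite /decayQ EFinM /=.
  by rewrite ge0_integralZl.
rewrite ge0_integralZr//; last exact: integral_ge0.
apply: lte_mul_pinfty => //; [exact: integral_ge0| |exact: integral_decay_lty].
by rewrite ge0_fin_numE ?integral_ge0// integral_decay_lty.
Qed.

(** Bounding 1 + t^2 by 1 + |z|^2 in each of the 2n factors of the weight, a decay
    of order 4n suffices. *)
Lemma schwartz_decay n (f : pt R n -> R) : schwartz f ->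
  exists2 M : R, 0 <= M & forall q r, `|f (q, r)| <= M * decayQ q.
Proof.
move=> /(_ [::]) [_ dec]; have [M0 /= hM0] := dec 0%N.
have [M1 /= hM1] := dec (2 * (n + n))%N.
have M00 : 0 <= M0 by apply: le_trans (hM0 0); rewrite expr0 mul1r.
have M10 : 0 <= M1 by apply: le_trans (hM1 0); rewrite mulr_ge0// exprn_ge0.
exists (2 ^+ (n + n) * (M0 + M1)); first by rewrite mulr_ge0 ?exprn_ge0 ?addr_ge0.
move=> q r; pose z : pt R n := (q, r).
have qz i : `|q.1 ord0 i| <= `|z|.
  rewrite (le_trans (norm_rV_coord _ _))// !prod_normE/= !le_max lexx//.
have qz' i : `|q.2 ord0 i| <= `|z|.
  by rewrite (le_trans (norm_rV_coord _ _))// !prod_normE/= !le_max lexx orbT.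
have decP (v : 'rV[R]_n) : (forall i, `|v ord0 i| <= `|z|) ->
    1 <= (1 + `|z| ^+ 2) ^+ n * decay v.
  move=> vz; rewrite /decay -[X in _ ^+ X](card_ord n) -prodr_const -big_split/=.
  elim/big_ind: _ => //= [a b a1 b1|i _].
    by rewrite -[1]mulr1 ler_pM.
  rewrite ler_pdivlMr ?mul1r ?ltr_pwDl ?sqr_ge0// lerD2l.
  by rewrite -[leLHS]real_normK ?num_real// lerXn2r ?nnegrE.
have key : 1 <= (1 + `|z| ^+ 2) ^+ (n + n) * decayQ q.
  rewrite exprD /decayQ mulrACA -[leLHS]mulr1 ler_pM//; exact: decP.
have expand : (1 + `|z| ^+ 2) ^+ (n + n) <= 2 ^+ (n + n) * (1 + `|z| ^+ (2 * (n + n))).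
  have t0 := sqr_ge0 `|z|; rewrite exprM; set t := _ ^+ 2 in t0 *.
  have [t1|t1] := leP t 1.
    apply: (@le_trans _ _ (2 ^+ (n + n))).
      by rewrite lerXn2r ?nnegrE//; lra.
    by rewrite ler_peMr ?exprn_ge0// lerDl exprn_ge0.
  apply: (@le_trans _ _ ((2 * t) ^+ (n + n))).
    by rewrite lerXn2r ?nnegrE//; lra.
  by rewrite exprMn ler_wpM2l ?exprn_ge0// lerDr.
have fz := normr_ge0 (f z).
apply: (@le_trans _ _ (`|f z| * ((1 + `|z| ^+ 2) ^+ (n + n) * decayQ q))).
  by rewrite ler_peMr.
rewrite mulrA ler_wpM2r ?decayQ_ge0//.
apply: (@le_trans _ _ (`|f z| * (2 ^+ (n + n) * (1 + `|z| ^+ (2 * (n + n)))))).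
  by rewrite ler_wpM2l.
rewrite mulrCA ler_wpM2l ?exprn_ge0// mulrDr mulr1 lerD//.
  by have := hM0 z; rewrite expr0 mul1r.
by rewrite mulrC; exact: hM1.
Qed.

Lemma schwartz_measurable n (f : pt R n -> R) : schwartz f -> measurable_fun setT f.
Proof.
move=> /(_ [::]) [df _]; apply: continuous_measurable_pt => z.
exact: differentiable_continuous.
Qed.

Lemma schwartz_csupp_measurable n (f : pt R n -> R[i]) : schwartz_csupp f ->
  cmeasurable f.
Proof. by move=> [f1 f2 _]; split; exact: schwartz_measurable. Qed.

Let sq_le (a b : R) : `|a| <= b -> a ^+ 2 <= b ^+ 2.
Proof. by move=> ab; rewrite -real_normK ?num_real// lerXn2r ?nnegrE// (le_trans _ ab). Qed.

Lemma schwartz_csupp_decay n (f : pt R n -> R[i]) : schwartz_csupp f ->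
  exists2 M : R, 0 < M & forall q r, sqmod (f (q, r)) <= (M * decayQ q) ^+ 2.
Proof.
move=> [/schwartz_decay[M1 M10 h1] /schwartz_decay[M2 M20 h2] _].
exists (M1 + M2 + 1) => [|q r]; first by rewrite ltr_wpDl ?addr_ge0.
have d0 := decayQ_ge0 q.
apply: (@le_trans _ _ ((M1 * decayQ q) ^+ 2 + (M2 * decayQ q) ^+ 2)).
  by rewrite lerD// sq_le.
rewrite ![(_ * decayQ q) ^+ 2]exprMn -mulrDl ler_wpM2r ?sqr_ge0//.
by have := mulr_ge0 M10 M20; rewrite !sqrrD; nra.
Qed.

Lemma schwartz_csupp_bounded n (f : pt R n -> R[i]) : schwartz_csupp f ->
  exists2 M : R, 0 < M & forall z r, sqmod (f (z, r)) <= (M * \1_`[- M, M] r) ^+ 2.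
Proof.
move=> [/(_ [::])[_ /(_ 0%N)[M1 h1]] /(_ [::])[_ /(_ 0%N)[M2 h2]] [K hK]].
have M10 : 0 <= M1 by apply: le_trans (h1 0); rewrite expr0 mul1r.
have M20 : 0 <= M2 by apply: le_trans (h2 0); rewrite expr0 mul1r.
exists (M1 + M2 + `|K| + 1) => [|[x y] r]; first by rewrite ltr_wpDl ?addr_ge0.
have K0 := normr_ge0 K; have KK := ler_norm K.
set M := (_ + 1); have [rM|rM] := leP `|r| M; last first.
  rewrite hK; last by move: rM; rewrite /M; lra.
  by rewrite /sqmod/= expr0n/= addr0 sqr_ge0.
rewrite indicE mem_set/= ?in_itv/= -?ler_norml// mulr1.
apply: (@le_trans _ _ (M1 ^+ 2 + M2 ^+ 2)).
  rewrite lerD// sq_le//.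
    by have := h1 (x, y, r); rewrite /= expr0 mul1r.
  by have := h2 (x, y, r); rewrite /= expr0 mul1r.
have := mulr_ge0 M10 M20; rewrite /M; set k := `|K| in K0 *; move=> ?; nra.
Qed.

End schwartz_bounds.

(** * Schur bounds for height changes and planar shifts *)

Arguments lebesgue_pt2 {R} n : simpl never.
Arguments lebesgue_pt {R} n : simpl never.
Arguments sfprod : simpl never.

Section schur_instances.
Context {R : realType} (n : nat).
Local Notation C := R[i].
Local Notation W := (pt R n * pt R n)%type.
Local Notation mu := (@lebesgue_pt2 R n).
Local Notation muQ := (sfprod (@lebesgue_rV R n) (@lebesgue_rV R n)).

(** Translations of the two planar blocks by amounts depending on the heights; they
    preserve Lebesgue measure. *)
Definition shift_flow (b : Q R n * (R * pt R n) -> Q R n)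
    (d : Q R n * (R * R) -> Q R n) (p : W * Q R n) : W :=
  let w := p.1 in
  ((w.1.1 + b (p.2, (w.1.2, w.2)), w.1.2),
   (w.2.1 + d (p.2, (w.1.2, w.2.2)), w.2.2)).

Lemma measurable_shift_flow b d : measurable_fun setT b -> measurable_fun setT d ->
  measurable_fun setT (shift_flow b d).
Proof.
move=> mb md; rewrite /shift_flow; measurability.
  by apply: (measurableT_comp mb); measurability.
by apply: (measurableT_comp md); measurability.
Qed.

Lemma ge0_integral_shift_flow b d q (h : W -> \bar R) :
  measurable_fun setT b -> measurable_fun setT d ->
  measurable_fun setT h -> (forall w, 0 <= h w)%E ->
  (\int[mu]_w h (shift_flow b d (w, q)) = \int[mu]_w h w)%E.
Proof.
move=> mb md mh h0.
have mbq : measurable_fun setT (fun p => b (q, p)).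
  by apply: (measurableT_comp mb); measurability.
have mdq : measurable_fun setT (fun p => d (q, p)).
  by apply: (measurableT_comp md); measurability.
have m1 : measurable_fun setT (fun _ : R * R => 1 : R) by exact: measurable_cst.
rewrite -(lebesgue_pt2_shear mbq m1 mdq _ mh h0); last by [].
apply: eq_integral => w _.
by rewrite !expr1n mul1e /shift_flow/= scale1r.
Qed.

Lemma schur_bounded_shift (K : W * Q R n -> C) b d (M : R) :
  cmeasurable K -> measurable_fun setT b -> measurable_fun setT d -> 0 < M ->
  (forall p, sqmod (K p) <= (M * decayQ p.2) ^+ 2) ->
  exists c, schur_bounded mu muQ K (shift_flow b d) (fun p => M * decayQ p.2) c c.
Proof.
move=> mK mb md M0 dom.
have mdQ : measurable_fun setT (fun q : Q R n => (decayQ q)%:E).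
  by apply/measurable_EFinP; exact: measurable_decayQ.
have dQ0 (q : Q R n) : (0 <= (decayQ q)%:E)%E by rewrite lee_fin decayQ_ge0.
pose I := (\int[muQ]_q (decayQ q)%:E)%E.
have I0 : (0 <= I)%E by exact: integral_ge0.
have Ifin : I \is a fin_num by rewrite ge0_fin_numE// integral_decayQ_lty.
have fI0 : 0 <= fine I by exact: fine_ge0.
exists (M * (fine I + 1)).
apply: (schur_bounded_preserving (k := fun q => M * decayQ q)) => //.
- exact: measurable_shift_flow.
- by apply: measurable_funM => //; exact: measurable_decayQ.
- by move=> q; rewrite mulr_ge0 ?decayQ_ge0 ?ltW.
- by rewrite mulr_gt0// ltr_wpDl.
- under eq_integral do rewrite EFinM.
  have M0' := ltW M0; rewrite ge0_integralZl ?lee_fin//.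
  rewrite [X in (_ * X <= _)%E](_ : _ = (fine I)%:E); last by rewrite fineK.
  rewrite -EFinM lee_fin.
  by rewrite ler_wpM2l ?ltW// ltrDl.
- by move=> q h mh h0; exact: ge0_integral_shift_flow.
Qed.

(** The displacement of lambda_phi, which replaces the height r by t. For fixed t this
    is not measure preserving, so the Schur test is applied in the variable r with the
    window function of width 2 M as dominating kernel. *)
Definition height_flow (p : W * R) : W := ((p.1.1.1, p.2), p.1.2).

Let window (M : R) (p : R * R) : R := M * \1_`[(- M), M]%classic (p.1 - p.2).

Let integral_window (M r : R) : 0 < M ->
  (\int[lebesgueR]_t (window M (r, t))%:E <= (M * (M + M))%:E)%E /\
  (\int[lebesgueR]_t (window M (t, r))%:E <= (M * (M + M))%:E)%E.
Proof.
move=> M0.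
have key : (\int[lebesgueR]_t (M * \1_`[(r - M), (r + M)]%classic t)%:E)%E = (M * (M + M))%:E.
  under eq_integral do rewrite EFinM.
  rewrite ge0_integralZl ?lee_fin ?ltW//; last first.
    by apply/measurable_EFinP; exact: measurable_indic.
  rewrite integral_indic; [|by []|exact: measurable_itv].
  rewrite setIT.
  transitivity (M%:E * lebesgue_measure (`[(r - M)%R, (r + M)%R]%classic : set R))%E; first by [].
  rewrite lebesgue_measure_itv/= lte_fin.
  have -> : r - M < r + M by lra.
  by rewrite -EFinB -EFinM; congr EFin; ring.
have cases (u t : R) : (- M <= u <= M) = (r - M <= t <= r + M) ->
    \1_`[(- M), M]%classic u = \1_`[(r - M), (r + M)]%classic t :> R.
  by move=> h; rewrite !indicE; congr (nat_of_bool _)%:R; apply/idP/idP;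
    rewrite !inE/= !in_itv/= h.
by split; rewrite -key le_eqVlt; apply/orP; left; apply/eqP; apply: eq_integral => t _;
  congr (_ * _)%:E; apply: cases => /=; apply/idP/idP; lra.
Qed.

Lemma schur_bounded_height (K : W * R -> C) (M : R) :
  cmeasurable K -> 0 < M ->
  (forall p, sqmod (K p) <= (M * \1_`[(- M), M]%classic (p.1.1.2 - p.2)) ^+ 2) ->
  exists k c, schur_bounded mu (@lebesgueR R) K height_flow k c c.
Proof.
move=> mK M0 dom; exists (fun p => window M (p.1.1.2, p.2)), (M * (M + M)).
apply: (schur_bounded_coordinate muQ (lebesgue_pt n) mK (k := window M) _ _ _ _ _ dom).
- apply: measurable_funM => //.
  by apply: (measurableT_comp (measurable_indic (measurable_itv _))); measurability.
- by move=> p; rewrite mulr_ge0// ltW.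
- by rewrite mulr_gt0// addr_gt0.
- by move=> r; have [] := integral_window r M0.
- by move=> r; have [] := integral_window r M0.
Qed.

End schur_instances.

(** * Phase identities *)

Section phases.
Context {R : realType} (n : nat) (lam : R).
Local Notation V := 'rV[R]_n.
Local Notation E r := (expR (lam * r)).
Local Notation eta := (Defs.eta lam).
Implicit Types (x y u v : V).

Lemma betaDl u v y : beta (u + v) y = beta u y + beta v y.
Proof. by rewrite /beta -big_split; apply: eq_bigr => i _; rewrite mxE mulrDl. Qed.

Lemma betaDr x u v : beta x (u + v) = beta x u + beta x v.
Proof. by rewrite /beta -big_split; apply: eq_bigr => i _; rewrite mxE mulrDr. Qed.

Lemma betaZl (c : R) x y : beta (c *: x) y = c * beta x y.
Proof. by rewrite /beta big_distrr/=; apply: eq_bigr => i _; rewrite mxE mulrA. Qed.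

Lemma betaZr (c : R) x y : beta x (c *: y) = c * beta x y.
Proof. by rewrite /beta big_distrr/=; apply: eq_bigr => i _; rewrite mxE mulrCA. Qed.

Lemma betaNl x y : beta (- x) y = - beta x y.
Proof. by rewrite -scaleN1r betaZl mulN1r. Qed.

Lemma betaNr x y : beta x (- y) = - beta x y.
Proof. by rewrite -scaleN1r betaZr mulN1r. Qed.

Definition betaE := (betaDl, betaDr, betaZl, betaZr, betaNl, betaNr).

Lemma expR_lam2 r : expR (2 * lam * r) = E r ^+ 2.
Proof. by rewrite expr2 -expRD; congr expR; ring. Qed.

(** For lam <> 0 both sides are 2 lam eta(r) eta(s), and for lam = 0 they vanish. *)
Lemma eta_symm (r s : R) : eta r * (E s ^+ 2 - 1) = eta s * (E r ^+ 2 - 1).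
Proof.
rewrite /Defs.eta; case: eqP => [->|/eqP lam0].
  by rewrite !mul0r !expR0 !expr1n !subrr !mulr0.
by rewrite !expR_lam2; field.
Qed.

Lemma etaD (r s : R) : eta (r + s) = eta s + E s ^+ 2 * eta r.
Proof.
rewrite /Defs.eta; case: eqP => [->|/eqP lam0].
  by rewrite mul0r expR0 expr1n mul1r addrC.
by rewrite !expR_lam2 expR_lamD; field.
Qed.

(** The exponent of the phase in the coordinates (u, v) = e^(- lam r) (xt, yt). *)
Definition angle (x y y' : V) (r' : R) (u v : V) (r : R) : R :=
  - eta r' * beta u y' + eta r * beta x v - eta r * E r' * beta u y
  + eta r' * E r ^+ 2 * beta u v + eta r * (1 - E r') * beta u v.

Lemma phaseE x y y' r' u v r :
  phase lam x y y' r' (E r *: u) (E r *: v) r = e (angle x y y' r' u v r).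
Proof.
have EN := expR_lamNK lam r.
rewrite /phase /ebar -!eD; congr e; rewrite /angle !scalerA expR_lamD -!mulrA !EN !scale1r.
by rewrite mulr1 !betaE; ring.
Qed.

(** The right-hand side collects the phase of Z at w, the phase of L_f at flowZ w and
    the inverse of the phase of Z at the displaced point. *)
Lemma angle_conj_Z x y r x' y' r' u v :
  let s := E r' in
  angle x y y' r' u v r =
  (eta r * beta (x - s *: x') y' - eta r * beta (s *: x') (y - s *: y'))
  - eta r' * beta (E r *: u) (E r *: (y' - v))
  - (eta r * beta (x + (1 - s) *: u - s *: (x' - u)) (y' - v)
     - eta r * beta (s *: (x' - u)) (y + (1 - s) *: v - s *: (y' - v))).
Proof.
move=> s; have := eta_symm r r'; rewrite /angle -/s !betaE; set h := eta r'; set t := eta r.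
set a := E r.
set b1 := beta x' y'; set b2 := beta u y'; set b3 := beta u v; set b4 := beta x v.
set b5 := beta u y; set b6 := beta x y'; set b7 := beta x' y; set b8 := beta x' v.
move=> rel.
have := congr1 ( *%R b2) rel; have := congr1 ( *%R b3) rel.
by lra.
Qed.

(** The cocycle identity behind associativity of the twisted product: translating
    by (u, v) at height r2 + rt and then by (u' - u, v' - v) at height rt. *)
Lemma angle_cocycle x y y' r' r2 rt u v u' v' :
  let s := E r' in let a := E rt in
  angle x y y' r' u v (r2 + rt)
  + angle (x + (1 - s) *: u) (y + (1 - s) *: v) (y' - v) r' (u' - u) (v' - v) rt
  = angle x y y' r' u' v' rt
  + angle (a *: x) (a *: y) (a *: v') r' (a *: u) (a *: v) r2.
Proof.
move=> s a; have := eta_symm rt r'; rewrite /angle etaD expR_lamD -/s -/a !betaE.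
set h := eta r'; set t := eta rt; set t2 := eta r2; set b := E r2.
set b1 := beta u y'; set b2 := beta x v; set b3 := beta u y; set b4 := beta u v.
set b5 := beta u' y'; set b6 := beta x v'; set b7 := beta u' y; set b8 := beta u' v'.
set b9 := beta u' v; set b10 := beta u v'.
move=> rel.
have := congr1 ( *%R b9) rel; have := congr1 ( *%R b4) rel.
by lra.
Qed.

End phases.

(** * The operators Pi of elementary tensors *)

Section tensor_operator.
Context {R : realType} (n : nat) (lam : R).
Local Notation C := R[i].
Local Notation W := (pt R n * pt R n)%type.
Local Notation mu := (@lebesgue_pt2 R n).
Local Notation muQ := (sfprod (@lebesgue_rV R n) (@lebesgue_rV R n)).
Local Notation leb := (@lebesgueR R).
Local Notation E r := (expR (lam * r)).
Local Notation eta := (Defs.eta lam).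
Implicit Types (f phi : pt R n -> C) (xi : W -> C).

(** Displacement and kernel of 1 (x) L_f, followed by those of Z (1 (x) L_f) Z^*. *)
Definition conv_flow : W * Q R n -> W :=
  shift_flow (fun=> 0) (fun p => - p.1).

Definition conv_kernel f (p : W * Q R n) : C :=
  let w := p.1 in let q := p.2 in
  f (q, w.2.2) * ebar (eta w.2.2 * beta q.1 (w.2.1.2 - q.2)).

Definition pi_flow : W * Q R n -> W :=
  shift_flow (fun p => (1 - E p.2.2.2) *: (E (- p.2.1) *: p.1))
             (fun p => - (E (- p.2.1) *: p.1)).

Definition pi_kernel f (p : W * Q R n) : C :=
  let w := p.1 in let q := p.2 in
  f (q, w.2.2) * phase lam w.1.1.1 w.1.1.2 w.2.1.2 w.2.2 q.1 q.2 w.1.2.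

Definition lambda_kernel phi (p : W * R) : C :=
  phi (E p.2 *: p.1.1.1, p.1.1.2 - p.2).

Lemma sqmod_phase x y y' r' (xt yt : 'rV[R]_n) rt : sqmod (phase lam x y y' r' xt yt rt) = 1.
Proof. by rewrite /phase /ebar !sqmodM !sqmod_e !mulr1. Qed.

Lemma cmeasurable_phase d (T : measurableType d) (x y y' : T -> 'rV[R]_n) (r' : T -> R)
    (xt yt : T -> 'rV[R]_n) (rt : T -> R) :
  measurable_fun setT x -> measurable_fun setT y -> measurable_fun setT y' ->
  measurable_fun setT r' -> measurable_fun setT xt -> measurable_fun setT yt ->
  measurable_fun setT rt ->
  cmeasurable (fun p => phase lam (x p) (y p) (y' p) (r' p) (xt p) (yt p) (rt p)).
Proof.
move=> mx my my' mr' mxt myt mrt; rewrite /phase /ebar.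
by repeat apply: cmeasurableM; apply: (cmeasurable_comp (@cmeasurable_e R)); measurability.
Qed.

Section kernels.
Variable f : pt R n -> C.
Hypothesis sf : schwartz_csupp f.

Lemma schur_bounded_conv : exists k c, schur_bounded mu muQ (conv_kernel f) conv_flow k c c.
Proof.
have [M M0 fM] := schwartz_csupp_decay sf; have mf := schwartz_csupp_measurable sf.
exists (fun p => M * decayQ p.2); apply: schur_bounded_shift => //.
- apply: cmeasurableM; first by apply: (cmeasurable_comp mf); measurability.
  by apply: (cmeasurable_comp (@cmeasurable_e R)); measurability.
- by measurability.
- by move=> p; rewrite sqmodM sqmod_e mulr1.
Qed.

Lemma schur_bounded_pi : exists k c, schur_bounded mu muQ (pi_kernel f) pi_flow k c c.
Proof.
have [M M0 fM] := schwartz_csupp_decay sf; have mf := schwartz_csupp_measurable sf.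
exists (fun p => M * decayQ p.2); apply: schur_bounded_shift => //.
- apply: cmeasurableM; first by apply: (cmeasurable_comp mf); measurability.
  by apply: cmeasurable_phase; measurability.
- by measurability.
- by measurability.
- by move=> p; rewrite sqmodM sqmod_phase mulr1.
Qed.

Lemma schur_bounded_lambda :
  exists k c, schur_bounded mu leb (lambda_kernel f) (@height_flow R n) k c c.
Proof.
have [M M0 fM] := schwartz_csupp_bounded sf; have mf := schwartz_csupp_measurable sf.
apply: (schur_bounded_height (M := M)) => //.
  by apply: (cmeasurable_comp mf); measurability.
by move=> p; exact: fM.
Qed.

End kernels.

Lemma tensor1l_Lop f xi : tensor1l (Lop lam f) xi = int_op muQ (conv_kernel f) conv_flow xi.
Proof.
apply: funext => -[[[x y] r] [[x' y'] r']]; rewrite /tensor1l /Lop /int_op /=.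
apply: eq_cintegral => -[xt yt] /=; rewrite /conv_kernel /conv_flow /shift_flow /= addr0.
by rewrite -mulrA [X in _ * X]mulrC mulrA.
Qed.

Lemma tensor1r_lambdaop phi xi :
  tensor1r (lambdaop lam phi) xi = int_op leb (lambda_kernel phi) (@height_flow R n) xi.
Proof. by apply: funext => -[[[x y] r] [[x' y'] r']]. Qed.

(** Conjugating the displacement of 1 (x) L_f by Z gives that of pi(L_f). *)
Lemma flowZV_conv_flow w q :
  flowZV lam (conv_flow (flowZ lam w, q)) = pi_flow (w, q).
Proof.
rewrite -[RHS](flowZK lam); congr (flowZV lam _).
case: w => [[z r] [z' r']]; rewrite /conv_flow /flowZ /pi_flow /shift_flow /=.
have -> : E r *: (z' - E (- r) *: q) = E r *: z' - q.
  by rewrite (scalerBr (E r) z') (scaler_lamVK lam r q).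
by rewrite scaler_telescope addr0.
Qed.

Lemma pi_kernelE f w q :
  (jacZ lam w)%:C%C * e (angleZ lam w) * (conv_kernel f (flowZ lam w, q) *
    ((jacZ lam (pi_flow (w, q)))^-1%:C%C * e (- angleZ lam (pi_flow (w, q))))) =
  pi_kernel f (w, q).
Proof.
pose p : Q R n := E (- w.1.2) *: q.
have qE : q = E w.1.2 *: p by rewrite scaler_lamVK.
rewrite (_ : jacZ lam (pi_flow (w, q)) = jacZ lam w)//.
have j0 : jacZ lam w != 0 by rewrite gt_eqF ?jacZ_gt0.
rewrite /pi_kernel /conv_kernel /= -[q.1]/((q : Q R n).1).
transitivity (f (q, w.2.2) * (((jacZ lam w)%:C%C * (jacZ lam w)^-1%:C%C) *
   (e (angleZ lam w) * ebar (eta w.2.2 * beta q.1 (E w.1.2 *: w.2.1.2 - q.2))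
   * e (- angleZ lam (pi_flow (w, q)))))); first by ring.
congr (_ * _); rewrite -rmorphM divff// rmorph1 mul1r /ebar -!eD.
have -> : q.1 = E w.1.2 *: p.1 by rewrite {1}qE.
have -> : q.2 = E w.1.2 *: p.2 by rewrite {1}qE.
rewrite phaseE; congr e; rewrite (angle_conj_Z lam _ _ _ w.2.1.1) /angleZ /=.
by rewrite [in RHS](scalerBr (E w.1.2)).
Qed.

Lemma Zop_measurable xi : cmeasurable xi -> cmeasurable (Zop lam xi).
Proof.
move=> mxi; rewrite (_ : Zop lam xi = fun w => (jacZ lam w)%:C%C * e (angleZ lam w) * xi (flowZ lam w)).
  apply: cmeasurableM; last exact: cmeasurable_comp mxi (measurable_flowZ lam).
  apply: cmeasurableM; first exact: cmeasurable_real (measurable_jacZ lam).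
  exact: cmeasurable_comp (@cmeasurable_e R) (measurable_angleZ lam).
by apply: funext => w; exact: ZopE.
Qed.

Section pi_representation.
Variables (f : pt R n -> C) (xi : W -> C).
Hypothesis sf : schwartz_csupp f.
Hypothesis xi2 : is_L2 mu xi.

Lemma cmeasurable_pi_rep : cmeasurable (pi_rep lam (Lop lam f) xi).
Proof.
have [k [c bd]] := schur_bounded_conv sf.
apply: Zop_measurable; rewrite tensor1l_Lop.
have [a2 _] := adjoint_Zop lam xi2.
exact: (cmeasurable_int_op bd (is_L2_measurable a2)).
Qed.

(** The adjoint of Z may be replaced by Zinv since 1 (x) L_f respects equality almost
    everywhere and flowZ pulls null sets back to null sets. The factor in front of the
    convolution integral can be moved inside because the latter converges absolutely
    at almost every point, hence at flowZ w for almost every w. *)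
Lemma pi_rep_int_op :
  {ae mu, forall w, pi_rep lam (Lop lam f) xi w = int_op muQ (pi_kernel f) pi_flow xi w}.
Proof.
have [k [c bd]] := schur_bounded_conv sf.
have [a2 aE] := adjoint_Zop lam xi2; have z2 := is_L2_Zinv lam xi2.
have := ae_eq_int_op bd (is_L2_measurable a2) (is_L2_measurable z2) aE.
move=> /(ae_flowZ lam) H1.
have /(ae_flowZ lam) H2 := ae_cintegrable_int_op bd z2.
apply: filterS2 H1 H2 => w H1 H2.
rewrite /pi_rep ZopE tensor1l_Lop H1 /int_op -cintegralZ.
  apply: eq_cintegral => q; rewrite /Zinv flowZV_conv_flow -pi_kernelE.
  by rewrite !mulrA.
exact: cintegrableZ.
Qed.

End pi_representation.

Definition tensor_kernel phi f : W * (R * Q R n) -> C :=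
  comp_kernel *%R (@height_flow R n) (lambda_kernel phi) (pi_kernel f).

Definition tensor_flow : W * (R * Q R n) -> W := comp_flow (@height_flow R n) pi_flow.

Lemma schur_bounded_tensor phi f : schwartz_csupp phi -> schwartz_csupp f ->
  exists k c, schur_bounded mu (sfprod leb muQ) (tensor_kernel phi f) tensor_flow k c c.
Proof.
move=> /schur_bounded_lambda[k1 [c1 b1]] /schur_bounded_pi[k2 [c2 b2]].
by exists (comp_kernel *%R (@height_flow R n) k1 k2), (c1 * c2); exact: schur_bounded_comp.
Qed.

Lemma Pi_tensor_int_op phi f xi : schwartz_csupp phi -> schwartz_csupp f ->
  is_L2 mu xi ->
  is_L2 mu (Pi_tensor lam phi f xi) /\
  {ae mu, forall w, Pi_tensor lam phi f xi w =
    int_op (sfprod leb muQ) (tensor_kernel phi f) tensor_flow xi w}.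
Proof.
move=> sphi sf xi2.
have [k1 [c1 b1]] := schur_bounded_lambda sphi.
have [k2 [c2 b2]] := schur_bounded_pi sf.
have [k [c b]] := schur_bounded_tensor sphi sf.
have mP := cmeasurable_pi_rep sf xi2.
have i2 := is_L2_int_op b2 xi2.
have eqP : {ae mu, forall w, Pi_tensor lam phi f xi w =
    int_op (sfprod leb muQ) (tensor_kernel phi f) tensor_flow xi w}.
  have H1 := ae_eq_int_op b1 mP (is_L2_measurable i2) (pi_rep_int_op sf xi2).
  apply: filterS2 H1 (int_op_comp b1 b2 xi2) => w H1 H2.
  by rewrite /Pi_tensor /pi'_rep tensor1r_lambdaop H1 H2.
split=> //; apply: (is_L2_ae _ (is_L2_int_op b xi2) eqP).
rewrite /Pi_tensor /pi'_rep tensor1r_lambdaop.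
exact: (cmeasurable_int_op b1 mP).
Qed.

End tensor_operator.

(** * Associativity of the twisted product *)

Section twisted_product.
Context {R : realType} (n : nat) (lam : R).
Local Notation C := R[i].
Local Notation X := (Q R n * R)%type.
Local Notation W := (pt R n * pt R n)%type.
Local Notation U := (R * Q R n)%type.
Local Notation mu := (@lebesgue_pt2 R n).
Local Notation muQ := (sfprod (@lebesgue_rV R n) (@lebesgue_rV R n)).
Local Notation leb := (@lebesgueR R).
Local Notation nu := (sfprod leb muQ).
Local Notation E r := (expR (lam * r)).

(** Successive displacements (r1, q1), (r3, q3) in terms of the total displacement
    (qt, rt) and of the variables (q2, r2) of the twisted product. *)
Definition regroup (v : X * X) : U * U :=
  ((v.2.2 + v.1.2, v.2.1), (v.1.2, v.1.1 - E (- v.2.2) *: v.2.1)).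

Lemma measurable_regroup : measurable_fun setT regroup.
Proof. by rewrite /regroup; measurability. Qed.

(** For fixed (rt, r2, q2) the map is a translation in qt, and then for fixed rt a
    translation in r2. *)
Lemma ge0_integral_regroup (G : U * U -> \bar R) : measurable_fun setT G ->
  (forall u, 0 <= G u)%E ->
  (\int[mu]_v G (regroup v) = \int[sfprod nu nu]_u G u)%E.
Proof.
move=> mG G0.
have mG1 : measurable_fun setT (fun v : X * X => G ((v.2.2, v.2.1), (v.1.2, v.1.1))).
  by apply: (measurableT_comp mG); measurability.
transitivity (\int[mu]_v G ((v.2.2, v.2.1), (v.1.2, v.1.1)))%E.
  have mGr := measurableT_comp mG measurable_regroup.
  rewrite (ge0_integral_pt2 mGr (fun=> G0 _)) (ge0_integral_pt2 mG1 (fun=> G0 _)).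
  apply: eq_integral => rt _.
  pose H r2 := (\int[muQ]_q2 \int[muQ]_qt G ((r2, q2), (rt, qt)))%E.
  have mH0 : measurable_fun setT (fun p : R * Q R n =>
      \int[muQ]_qt G ((p.1, p.2), (rt, qt)))%E.
    apply: (measurable_fun_fubini_tonelli_F (fun p : (R * Q R n) * Q R n =>
      G ((p.1.1, p.1.2), (rt, p.2)))) => //.
    by apply: (measurableT_comp mG); measurability.
  have mH : measurable_fun setT H.
    apply: (measurable_fun_fubini_tonelli_F (fun p : R * Q R n =>
      \int[muQ]_qt G ((p.1, p.2), (rt, qt)))%E) => //.
    by move=> p; exact: integral_ge0.
  have H0 r2 : (0 <= H r2)%E by do 2 (apply: integral_ge0 => ? _).
  transitivity (\int[leb]_r2 H (r2 + rt)%R)%E; last exact: lebesgueR_shift.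
  apply: eq_integral => r2 _; apply: eq_integral => q2 _.
  have mG2 : measurable_fun setT (fun qt : Q R n => G ((r2 + rt, q2), (rt, qt))).
    by apply: (measurableT_comp mG); measurability.
  rewrite -(lebesgue_Q_shift (- (E (- r2) *: q2)) mG2 (fun=> G0 _)).
  by apply: eq_integral => qt _.
rewrite (ge0_integral_pt2 mG1 (fun=> G0 _)) [RHS]fubini_tonelli1//.
rewrite (_ : fubini_F nu G = fun u => \int[leb]_r3 \int[muQ]_q3 G (u, (r3, q3)))%E; last first.
  apply: funext => u; rewrite /fubini_F fubini_tonelli1//.
  by apply: (measurableT_comp mG); measurability.
have mu3 : measurable_fun setT (fun p : U * R => \int[muQ]_q3 G (p.1, (p.2, q3)))%E.
  apply: (measurable_fun_fubini_tonelli_F (fun p : (U * R) * Q R n =>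
    G (p.1.1, (p.1.2, p.2)))) => //.
  by apply: (measurableT_comp mG); measurability.
rewrite (fubini_tonelli (fun p : U * R => \int[muQ]_q3 G (p.1, (p.2, q3)))%E)//; last first.
  by move=> p; exact: integral_ge0.
apply: eq_integral => r3 _.
rewrite [RHS](fubini_tonelli1 (fun u : U => \int[muQ]_q3 G (u, (r3, q3)))%E)//.
- have mr : measurable_fun setT (fun u : U => (u, r3)) by measurability.
  exact: (measurableT_comp mu3 mr).
- by move=> u; exact: integral_ge0.
Qed.

Variables phi f psi g : pt R n -> C.

(** The displacement of the operator Pi; mul_arg below is the argument at which
    Pi evaluates F. *)
Definition total_flow (p : W * X) : W := tensor_flow lam (p.1, (p.2.2, p.2.1)).

Definition mul_kernel (p : W * X) : C :=
  let w := p.1 in let t := p.2 in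
  phi (E t.2 *: w.1.1, w.1.2 - t.2)
  * psi (w.1.1 + (1 - E w.2.2) *: (E (- t.2) *: t.1), t.2)
  * phase lam w.1.1.1 w.1.1.2 w.2.1.2 w.2.2 t.1.1 t.1.2 t.2
  * f (t.1, w.2.2) * g (w.2.1 - E (- t.2) *: t.1, w.2.2).

Definition mul_arg (p : W * X) : W :=
  ((E p.2.2 *: p.1.1.1, p.1.1.2 - p.2.2), (p.2.1, p.1.2.2)).

Definition Pi_phase (p : W * X) : C :=
  let w := p.1 in let t := p.2 in
  phase lam w.1.1.1 w.1.1.2 w.2.1.2 w.2.2 t.1.1 t.1.2 t.2.

Let flow_expand (M : lmodType R) (z q : M) (r' r : R) :
  z - E (r' - r) *: q + E (- r) *: q = z + (1 - E r') *: (E (- r) *: q).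
Proof.
by rewrite scalerBl scale1r scalerA -expR_lamD -addrA [- _ + _]addrC.
Qed.

Lemma mul_tensorE w : mul_tensor lam phi f psi g w =
  cintegral (lebesgue_pt n) (fun t => mul_kernel (w, t)).
Proof.
case: w => [[[x y] r] [[x' y'] r']]; apply: eq_cintegral => -[[xt yt] rt].
by rewrite /mul_kernel /= !flow_expand.
Qed.

Lemma PiE F xi w : Pi lam F xi w = cintegral (lebesgue_pt n) (fun t =>
  F (mul_arg (w, t)) * Pi_phase (w, t) * xi (total_flow (w, t))).
Proof.
case: w => [[[x y] r] [[x' y'] r']]; apply: eq_cintegral => -[[xt yt] rt].
by rewrite /Pi_phase /mul_arg /= !flow_expand.
Qed.

End twisted_product.

Section associativity.
Context {R : realType} (n : nat) (lam : R).
Local Notation C := R[i].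
Local Notation X := (Q R n * R)%type.
Local Notation W := (pt R n * pt R n)%type.
Local Notation U := (R * Q R n)%type.
Local Notation mu := (@lebesgue_pt2 R n).
Local Notation muQ := (sfprod (@lebesgue_rV R n) (@lebesgue_rV R n)).
Local Notation leb := (@lebesgueR R).
Local Notation nu := (sfprod leb muQ).
Local Notation E r := (expR (lam * r)).
Variables phi f psi g : pt R n -> C.

Let scalerDE (M : lmodType R) (a c : R) (u v : M) :
  a *: (u + c *: v) = a *: u + c *: (a *: v).
Proof. by rewrite scalerDr !scalerA mulrC. Qed.

Let telescopeN (M : lmodType R) (z u v : M) : z - u - (v - u) = z - v.
Proof. by rewrite opprB addrA addrNK. Qed.

Lemma tensor_flowE (z : Q R n) r (z' : Q R n) r' t (q : Q R n) :
  tensor_flow lam (((z, r), (z', r')), (t, q)) =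
  ((z + (1 - E r') *: (E (- t) *: q), t), (z' - E (- t) *: q, r')).
Proof. by []. Qed.

Lemma tensor_kernelE a b (z : Q R n) r (z' : Q R n) r' t (q : Q R n) :
  tensor_kernel lam a b (((z, r), (z', r')), (t, q)) =
  a (E t *: z, r - t) * (b (q, r') * phase lam z.1 z.2 z'.2 r' q.1 q.2 t).
Proof. by []. Qed.

(** Displacing by (r1, q1) and then by (r3, q3) amounts to the displacement (rt, qt):
    after rescaling q2 = e^(lam (r2 + rt)) u and qt = e^(lam rt) v, the steps are u and
    v - u. *)
Lemma tensor_flow_regroup (w : W) (v : X * X) :
  comp_flow (tensor_flow lam) (tensor_flow lam) (w, regroup lam v) =
  total_flow lam (w, v.1).
Proof.
case: w v => [[z r] [z' r']] [[qt rt] [q2 r2]].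
transitivity (tensor_flow lam (tensor_flow lam (((z, r), (z', r')), (r2 + rt, q2)),
  (rt, qt - E (- r2) *: q2))); first by [].
rewrite /total_flow !tensor_flowE.
have [u ->] : exists u, q2 = E (r2 + rt) *: u.
  by exists (E (- (r2 + rt)) *: q2); rewrite scaler_lamVK.
have [v ->] : exists v, qt = E rt *: v.
  by exists (E (- rt) *: qt); rewrite scaler_lamVK.
rewrite (scaler_lamK lam (r2 + rt) u) (scaler_lamDK lam r2 rt u) -(scalerBr (E rt) v u).
by rewrite (scaler_lamK lam rt v) (scaler_lamK lam rt (v - u)) scaler_telescope telescopeN.
Qed.

Lemma tensor_kernel_regroup (w : W) (v : X * X) :
  comp_kernel *%R (tensor_flow lam) (tensor_kernel lam phi f) (tensor_kernel lam psi g)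
    (w, regroup lam v) =
  mul_kernel lam phi f psi g (mul_arg lam (w, v.1), v.2) * Pi_phase lam (w, v.1).
Proof.
case: w v => [[z r] [z' r']] [[qt rt] [q2 r2]].
transitivity (tensor_kernel lam phi f (((z, r), (z', r')), (r2 + rt, q2)) *
  tensor_kernel lam psi g (tensor_flow lam (((z, r), (z', r')), (r2 + rt, q2)),
    (rt, qt - E (- r2) *: q2))); first by [].
transitivity (phi (E r2 *: (E rt *: z), r - rt - r2)
  * psi (E rt *: z + (1 - E r') *: (E (- r2) *: q2), r2)
  * phase lam (E rt *: z.1) (E rt *: z.2) qt.2 r' q2.1 q2.2 r2
  * f (q2, r') * g (qt - E (- r2) *: q2, r')
  * phase lam z.1 z.2 z'.2 r' qt.1 qt.2 rt); last by [].
rewrite tensor_flowE !tensor_kernelE.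
have [u ->] : exists u, q2 = E (r2 + rt) *: u.
  by exists (E (- (r2 + rt)) *: q2); rewrite scaler_lamVK.
have [v ->] : exists v, qt = E rt *: v.
  by exists (E (- rt) *: qt); rewrite scaler_lamVK.
rewrite (scaler_lamK lam (r2 + rt) u) (scaler_lamDK lam r2 rt u) -(scalerBr (E rt) v u).
have key :
  phase lam z.1 z.2 z'.2 r' (E (r2 + rt) *: u.1) (E (r2 + rt) *: u.2) (r2 + rt)
  * phase lam (z.1 + (1 - E r') *: u.1) (z.2 + (1 - E r') *: u.2) (z'.2 - u.2) r'
      (E rt *: (v.1 - u.1)) (E rt *: (v.2 - u.2)) rt
  = phase lam z.1 z.2 z'.2 r' (E rt *: v.1) (E rt *: v.2) rt
  * phase lam (E rt *: z.1) (E rt *: z.2) (E rt *: v.2) r'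
      (E (r2 + rt) *: u.1) (E (r2 + rt) *: u.2) r2.
  rewrite (phaseE lam z.1 z.2 z'.2 r' u.1 u.2 (r2 + rt)).
  rewrite (phaseE lam _ _ _ r' (v.1 - u.1) (v.2 - u.2) rt).
  rewrite (phaseE lam z.1 z.2 z'.2 r' v.1 v.2 rt).
  rewrite (scaler_lamD lam r2 rt u.1) (scaler_lamD lam r2 rt u.2).
  rewrite (phaseE lam _ _ _ r' (E rt *: u.1) (E rt *: u.2) r2).
  by rewrite -!eD; congr e; exact: angle_cocycle.
rewrite (scalerDE (E rt) _ z u) (scaler_lamD lam r2 rt z).
have -> : r - (r2 + rt) = r - rt - r2 :> R by ring.
have -> : r2 + rt - rt = r2 :> R by ring.
move: key => /=; set p1 := phase _ _ _ _ _ _ _ _; set p2 := phase _ _ _ _ _ _ _ _.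
set p3 := phase _ _ _ _ _ _ _ _; set p4 := phase _ _ _ _ _ _ _ _ => key.
set a1 := phi _; set a2 := f _; set a3 := psi _; set a4 := g _.
transitivity (a1 * a3 * a2 * a4 * (p1 * p2)); first by ring.
by rewrite key; ring.
Qed.

Lemma cmeasurable_mul_kernel : schwartz_csupp phi -> schwartz_csupp f ->
  schwartz_csupp psi -> schwartz_csupp g ->
  cmeasurable (fun p : W * X => mul_kernel lam phi f psi g p).
Proof.
move=> /schwartz_csupp_measurable mphi /schwartz_csupp_measurable mf.
move=> /schwartz_csupp_measurable mpsi /schwartz_csupp_measurable mg.
rewrite /mul_kernel; apply: cmeasurableM; first apply: cmeasurableM.
- apply: cmeasurableM; first apply: cmeasurableM.
  + by apply: (cmeasurable_comp mphi); measurability.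
  + by apply: (cmeasurable_comp mpsi); measurability.
  + by apply: cmeasurable_phase; measurability.
- by apply: (cmeasurable_comp mf); measurability.
- by apply: (cmeasurable_comp mg); measurability.
Qed.

Hypotheses (sphi : schwartz_csupp phi) (sf : schwartz_csupp f).
Hypotheses (spsi : schwartz_csupp psi) (sg : schwartz_csupp g).

Lemma cmeasurable_mul_tensor : cmeasurable (mul_tensor lam phi f psi g).
Proof.
rewrite (_ : mul_tensor _ _ _ _ _ = fun w => cintegral (lebesgue_pt n)
  (fun t => mul_kernel lam phi f psi g (w, t))); last first.
  by apply: funext => w; exact: mul_tensorE.
apply: (cmeasurable_cintegral (lebesgue_pt n) (f := mul_kernel lam phi f psi g)).
exact: cmeasurable_mul_kernel.
Qed.

Lemma cmeasurable_Pi_integrand (F : W -> C) (xi : W -> C) : cmeasurable F -> cmeasurable xi ->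
  cmeasurable (fun p : W * X => F (mul_arg lam p) * Pi_phase lam p * xi (total_flow lam p)).
Proof.
move=> mF mxi; apply: cmeasurableM.
  apply: cmeasurableM.
    by apply: (cmeasurable_comp mF); rewrite /mul_arg; measurability.
  by rewrite /Pi_phase; apply: cmeasurable_phase; measurability.
apply: (cmeasurable_comp mxi).
rewrite (_ : total_flow lam = fun p : W * X =>
  ((p.1.1.1 + (1 - E p.1.2.2) *: (E (- p.2.2) *: p.2.1), p.2.2),
   (p.1.2.1 - E (- p.2.2) *: p.2.1, p.1.2.2))) //.
by measurability.
Qed.

Lemma cmeasurable_Pi (F : W -> C) (xi : W -> C) : cmeasurable F -> cmeasurable xi ->
  cmeasurable (Pi lam F xi).
Proof.
move=> mF mxi; rewrite (_ : Pi _ _ _ = fun w => cintegral (lebesgue_pt n) (fun t =>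
  F (mul_arg lam (w, t)) * Pi_phase lam (w, t) * xi (total_flow lam (w, t)))); last first.
  by apply: funext => w; exact: PiE.
apply: (cmeasurable_cintegral (lebesgue_pt n) (f := fun p =>
  F (mul_arg lam p) * Pi_phase lam p * xi (total_flow lam p))).
exact: cmeasurable_Pi_integrand.
Qed.

(** Read from right to left: in the integral over both displacements, regroup, integrate
    over (q2, r2) first, and recognise the twisted product. *)
Lemma Pi_mul_tensor_int_op xi : is_L2 mu xi ->
  {ae mu, forall w, Pi lam (mul_tensor lam phi f psi g) xi w =
    int_op (sfprod nu nu)
      (comp_kernel *%R (tensor_flow lam) (tensor_kernel lam phi f) (tensor_kernel lam psi g))
      (comp_flow (tensor_flow lam) (tensor_flow lam)) xi w}.
Proof.
move=> xi2; have mxi := is_L2_measurable xi2.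
have [k1 [c1 b1]] := schur_bounded_tensor lam sphi sf.
have [k2 [c2 b2]] := schur_bounded_tensor lam spsi sg.
have := ae_cintegrable_int_op (schur_bounded_comp b1 b2) xi2.
apply: filterS => w iw.
have pres := @ge0_integral_regroup R n lam.
have mreg := @measurable_regroup R n lam.
have iG := cintegrable_preserving mreg pres iw.
rewrite /int_op -(cintegral_preserving pres (cintegrable_measurable iw)).
rewrite -(cintegral_fubini iG) PiE; apply: ae_eq_cintegral.
- apply: (cmeasurable_comp (cmeasurable_Pi_integrand cmeasurable_mul_tensor mxi)).
  exact: measurable_pair1.
- exact: (cmeasurable_cintegral (lebesgue_pt n) (cintegrable_measurable iG)).
have := ae_cintegrable1 iG; apply: filterS => t it.
have E1 p : comp_kernel *%R (tensor_flow lam) (tensor_kernel lam phi f)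
      (tensor_kernel lam psi g) (w, regroup lam (t, p)) *
    xi (comp_flow (tensor_flow lam) (tensor_flow lam) (w, regroup lam (t, p))) =
  (Pi_phase lam (w, t) * xi (total_flow lam (w, t))) *
    mul_kernel lam phi f psi g (mul_arg lam (w, t), p).
  by rewrite tensor_kernel_regroup tensor_flow_regroup /=; ring.
rewrite (eq_cintegral _ E1) cintegralZ.
  by rewrite mul_tensorE -mulrA mulrC.
by congr cintegrable: it; apply: funext => p; exact: E1.
Qed.

Lemma Pi_tensor_comp_int_op xi : is_L2 mu xi ->
  is_L2 mu (Pi_tensor lam phi f (Pi_tensor lam psi g xi)) /\
  {ae mu, forall w, Pi_tensor lam phi f (Pi_tensor lam psi g xi) w =
    int_op (sfprod nu nu)
      (comp_kernel *%R (tensor_flow lam) (tensor_kernel lam phi f) (tensor_kernel lam psi g))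
      (comp_flow (tensor_flow lam) (tensor_flow lam)) xi w}.
Proof.
move=> xi2.
have [k1 [c1 b1]] := schur_bounded_tensor lam sphi sf.
have [k2 [c2 b2]] := schur_bounded_tensor lam spsi sg.
have [z2 zE] := Pi_tensor_int_op lam spsi sg xi2.
have [y2 yE] := Pi_tensor_int_op lam sphi sf z2.
split=> //.
have i2 := is_L2_int_op b2 xi2.
have H := ae_eq_int_op b1 (is_L2_measurable z2) (is_L2_measurable i2) zE.
have H2 := int_op_comp b1 b2 xi2.
by apply: filterS3 yE H H2 => w -> -> ->.
Qed.

End associativity.

Theorem proposition3p7 (R : realType) (n : nat) (lam : R) (hn : (0 < n)%N)
    (phi psi f g : pt R n -> complex R)
    (hphi : schwartz_csupp phi) (hpsi : schwartz_csupp psi)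
    (hf : schwartz_csupp f) (hg : schwartz_csupp g) :
  eq_operator (lebesgue_pt2 n)
    (fun xi => Pi_tensor lam phi f (Pi_tensor lam psi g xi))
    (Pi lam (mul_tensor lam phi f psi g)).
Proof.
move=> xi xi2.
have [l2 lE] := Pi_tensor_comp_int_op lam hphi hf hpsi hg xi2.
have rE := Pi_mul_tensor_int_op lam hphi hf hpsi hg xi2.
have mP := cmeasurable_Pi lam (cmeasurable_mul_tensor lam hphi hf hpsi hg)
  (is_L2_measurable xi2).
have eqP : {ae lebesgue_pt2 n, forall w, Pi_tensor lam phi f (Pi_tensor lam psi g xi) w =
    Pi lam (mul_tensor lam phi f psi g) xi w}.
  by apply: filterS2 lE rE => w -> ->.
split=> //; apply: (is_L2_ae mP l2).
by apply: filterS eqP => w ->.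
Qed.
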